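(* Let $I,J$ be increasing tuples in $\{1,\dots,n\}$ with $|I|=|J|=r$, and let $I',J'$ be their increasing complements in $\{1,\dots,n\}$. Let $M$ be the length of the standard column tower of $J$ in $\{1,\dots,n\}$ and $N$ the length of the standard row tower of $I$ in $\{1,\dots,n\}$. Then in $\mathcal O_q(M_n(k))$ $$[I',J'][I,J]=\sum_{i=0}^{M+N}(q^{-1}-q)^i\sum_{(Z,W)\in C_i^{I,J}}\mathrm{sign}(Z,W)\,[Z,W]\,[Z',W'],$$ where the lists $C_i^{I,J}$ and the signs are defined in the context.
   Context: Let $k$ be a field, $q$ an indeterminate, $k_q=k[q,q^{-1}]$. $\mathcal O_q(M_n(k))$ is the $k_q$-algebra generated by $x_{ij}$, $1\le i,j\le n$, with relations: $x_{ij}x_{ik}=q^{-1}x_{ik}x_{ij}$ and $x_{ji}x_{ki}=q^{-1}x_{ki}x_{ji}$ for $j<k$; $x_{ij}x_{kl}=x_{kl}x_{ij}$ if $i<k,\ j>l$ or $i>k,\ j<l$; $x_{ij}x_{kl}-x_{kl}x_{ij}=(q^{-1}-q)x_{kj}x_{il}$ if $i<k,\ j<l$. Quantum minors: for increasing tuples $A=(a_1<\dots<a_p)$, $B=(b_1<\dots<b_p)$, $[A,B]=\sum_{\sigma\in S_p}(-q)^{-l(\sigma)}x_{a_1b_{\sigma(1)}}\cdots x_{a_pb_{\sigma(p)}}$, with $l(\sigma)$ the number of inversions. For a tuple $S$ of distinct integers, $S_{ord}$ is its increasing rearrangement and $l(S)$ its number of inversions; for tuples $A,B$ of distinct entries not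 necessarily increasing, $[A,B]:=(-q)^{-l(A)-l(B)}[A_{ord},B_{ord}]$. Standard column tower of $J=(j_1<\dots<j_r)$ in $\{1,\dots,n\}$: if $J\ne(n-r+1,\dots,n)$ put $j_{r+1}=n+1$, let $p$ be the largest index in $\{1,\dots,r\}$ with $j_{p+1}-j_p>1$, and $\sigma_J=(j_p,j_p+1)$. Iterating gives $J=J_M<\dots<J_0=(n-r+1,\dots,n)$ with $J_{s-1}=\sigma^c_s(J_s)$, $\sigma^c_s=\sigma_{J_s}$. Standard row tower of $I=(i_1<\dots<i_r)$: if $I\ne(1,\dots,r)$ put $i_0=0$, let $p$ be the smallest index in $\{1,\dots,r\}$ with $i_p-i_{p-1}>1$, and $\sigma_I=(i_p,i_p-1)$. Iterating gives $I=I_N>\dots>I_0=(1,\dots,r)$ with $I_{t-1}=\sigma^r_t(I_t)$, $\sigma^r_t=\sigma_{I_t}$. The lists $C_i^{I_t,J_s}$ are finite lists (with multiplicity) of elements written $(Z,W)$, each carrying a sign; an element really records four tuples $Z,Z',W,W'$ of distinct, not necessarily increasing entries, where $Z'$ (resp. $W'$) has as entries the complement of the entries of $Z$ (resp. $W$). $C_0^{I_0,J_0}$ consists of the single element $(I_0,J_0)$ with $Z'=I_0'$, $W'=J_0'$ increasing; $C_i^{I_t,J_s}$ is empty if $i<0$ or $i>s+t$. Column steps, $1\le s\le M$: $C_i^{I_0,J_s}$ is the concatenation of $C_{i-1}^{I_0,J_{s-1}}$ with $\phi_{i-1}^{I_0,J_{s-1}}$ removed and of $\sigma^c_s(C_i^{I_0,J_{s-1}})$,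 where $\sigma^c_s=(m,m+1)$ acts on every entry of $W$ and $W'$ (no reordering) and $\phi_{i-1}^{I_0,J_{s-1}}$ is the sublist of those elements for which $m$ appears before $m+1$ in the concatenated tuple $(W,W')$. Elements of $C_i^{I_0,J_s}$ have sign $(-1)^i$. Row steps, $1\le t\le N$: $C_i^{I_t,J_M}$ is the concatenation of $C_{i-1}^{I_{t-1},J_M}$ with $\psi_{i-1}^{I_{t-1},J_M}$ removed and of $\sigma^r_t(C_i^{I_{t-1},J_M})$, where $\sigma^r_t=(m,m+1)$ acts on every entry of $Z$ and $Z'$ (no reordering) and $\psi_{i-1}^{I_{t-1},J_M}$ is the sublist of those elements for which $m+1$ appears before $m$ in the concatenated tuple $(Z,Z')$. In row steps the sign of each element is inherited from the element of the previous list from which it comes (unchanged, also under $\sigma_t^r$). Finally $C_i^{I,J}:=C_i^{I_N,J_M}$. Sums over $C_i^{I,J}$ count multiplicity. *)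

(* Defs.v *)
From HB Require Import structures.
From mathcomp Require Import all_boot all_order all_algebra all_fingroup.
From mathcomp Require Import generic_quotient boolp.
From mathcomp Require Import monalg.

Set Implicit Arguments.
Unset Strict Implicit.
Unset Printing Implicit Defensive.

Import GRing.Theory.
Local Open Scope ring_scope.
Local Open Scope quotient_scope.

(* k[q, q^-1], as the subring { p / q^m } of k(q) *)
Section Laurent.
Variable k : fieldType.

Definition fracX : {fraction {poly k}} := FracField.tofrac 'X.

Definition is_laurent : {pred {fraction {poly k}}} :=
  fun f => `[< exists (p : {poly k}) (m : nat),
                 f = FracField.tofrac p / fracX ^+ m >].

Lemma fracX_neq0 : fracX != 0.
Proof. by rewrite /fracX tofrac_eq0 polyX_eq0. Qed.

Lemma is_laurent_subring : subring_closed is_laurent.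
Proof.
have Xn m : fracX ^+ m != 0 by rewrite expf_neq0 ?fracX_neq0.
split=> [|_ _ /asboolP[p [m ->]] /asboolP[p' [m' ->]]
        |_ _ /asboolP[p [m ->]] /asboolP[p' [m' ->]]]; apply/asboolP.
- by exists 1, 0; rewrite expr0 divr1 tofrac1.
- exists (p * 'X^m' - p' * 'X^m), (m + m')%N.
  rewrite -mulNr addf_div; [|exact: Xn|exact: Xn].
  by rewrite exprD tofracD tofracN !tofracM !tofracXn mulNr.
- exists (p * p'), (m + m')%N.
  by rewrite mulf_div exprD tofracM.
Qed.

HB.instance Definition _ :=
  GRing.isSubringClosed.Build _ is_laurent is_laurent_subring.

Record laurent := Laurent
  { laurent_val : {fraction {poly k}}; _ : laurent_val \in is_laurent }.

HB.instance Definition _ := [isSub for laurent_val].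
HB.instance Definition _ := [Choice of laurent by <:].
HB.instance Definition _ := [SubChoice_isSubComNzRing of laurent by <:].

Fact q_key : fracX \in is_laurent.
Proof. by apply/asboolP; exists 'X, 0; rewrite expr0 divr1. Qed.

Fact qinv_key : fracX^-1 \in is_laurent.
Proof. by apply/asboolP; exists 1, 1; rewrite tofrac1 div1r expr1. Qed.

Definition q : laurent := Laurent q_key.
Definition qinv : laurent := Laurent qinv_key.

Lemma q_qinv : q * qinv = 1.
Proof. by apply: val_inj; rewrite /= divff ?fracX_neq0. Qed.

End Laurent.

Section QuotientAlgebra.
Variables (R : nzRingType) (A : lalgType R) (G : A -> Prop).

(* The two-sided ideal generated by G *)
Inductive ideal_gen : A -> Prop :=
| ideal_gen_in x : G x -> ideal_gen x
| ideal_gen0 : ideal_gen 0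
| ideal_genD x y : ideal_gen x -> ideal_gen y -> ideal_gen (x + y)
| ideal_genM a b x : ideal_gen x -> ideal_gen (a * x * b).

Lemma ideal_genN x : ideal_gen x -> ideal_gen (- x).
Proof. by move=> /(ideal_genM (-1) 1); rewrite mulN1r mulr1. Qed.

Lemma ideal_genMl a x : ideal_gen x -> ideal_gen (a * x).
Proof. by move=> /(ideal_genM a 1); rewrite mulr1. Qed.

Lemma ideal_genMr a x : ideal_gen x -> ideal_gen (x * a).
Proof. by move=> /(ideal_genM 1 a); rewrite mul1r. Qed.

Definition eqv (x y : A) : bool := `[< ideal_gen (x - y) >].

Lemma eqv_equiv : equiv_class_of eqv.
Proof.
split=> [x|x y|y x z].
- by apply/asboolP; rewrite subrr; apply: ideal_gen0.
- by apply/asboolP/asboolP => /ideal_genN; rewrite opprB.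
- move=> /asboolP xy /asboolP yz; apply/asboolP.
  by rewrite -(subrKA y); apply: ideal_genD.
Qed.

Canonical eqv_equivRel := EquivRelPack eqv_equiv.

Definition quot_alg := {eq_quot eqv}.
HB.instance Definition _ := Choice.on quot_alg.
HB.instance Definition _ := EqQuotient.on quot_alg.

Definition qpi (x : A) : quot_alg := \pi x.

Lemma qpiP x y : qpi x = qpi y <-> ideal_gen (x - y).
Proof.
by split=> [/eqmodP/asboolP|?] //; apply/eqmodP/asboolP.
Qed.

Lemma qpi_ind (P : quot_alg -> Prop) : (forall x, P (qpi x)) -> forall u, P u.
Proof. by move=> h; elim/quotW. Qed.

Lemma qpi_repr (u : quot_alg) : qpi (repr u) = u.
Proof. exact: reprK. Qed.

Lemma repr_qpi x : ideal_gen (repr (qpi x) - x).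
Proof. by apply/qpiP; rewrite qpi_repr. Qed.

Definition qadd (u v : quot_alg) := qpi (repr u + repr v).
Definition qopp (u : quot_alg) := qpi (- repr u).
Definition qmul (u v : quot_alg) := qpi (repr u * repr v).
Definition qscale (a : R) (u : quot_alg) := qpi (a *: repr u).

Lemma qaddE x y : qadd (qpi x) (qpi y) = qpi (x + y).
Proof. by apply/qpiP; rewrite opprD addrACA; apply: ideal_genD; apply: repr_qpi. Qed.

Lemma qoppE x : qopp (qpi x) = qpi (- x).
Proof. by apply/qpiP; rewrite -opprD; apply/ideal_genN/repr_qpi. Qed.

Lemma qmulE x y : qmul (qpi x) (qpi y) = qpi (x * y).
Proof.
apply/qpiP; set x' := repr _; set y' := repr _.
have -> : x' * y' - x * y = (x' - x) * y' + x * (y' - y).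
  by rewrite mulrBl mulrBr subrKA.
apply: ideal_genD; first exact/ideal_genMr/repr_qpi.
exact/ideal_genMl/repr_qpi.
Qed.

Lemma qscaleE a x : qscale a (qpi x) = qpi (a *: x).
Proof.
apply/qpiP; rewrite -scalerBr -[_ - _]mul1r scalerAl.
exact/ideal_genMl/repr_qpi.
Qed.

Lemma qaddA : associative qadd.
Proof.
by elim/qpi_ind=> x; elim/qpi_ind=> y; elim/qpi_ind=> z; rewrite !qaddE addrA.
Qed.

Lemma qaddC : commutative qadd.
Proof. by elim/qpi_ind=> x; elim/qpi_ind=> y; rewrite !qaddE addrC. Qed.

Lemma qadd0 : left_id (qpi 0) qadd.
Proof. by elim/qpi_ind=> x; rewrite qaddE add0r. Qed.

Lemma qaddN : left_inverse (qpi 0) qopp qadd.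
Proof. by elim/qpi_ind=> x; rewrite qoppE qaddE addNr. Qed.

HB.instance Definition _ :=
  GRing.isZmodule.Build quot_alg qaddA qaddC qadd0 qaddN.

Lemma qmulA : associative qmul.
Proof.
by elim/qpi_ind=> x; elim/qpi_ind=> y; elim/qpi_ind=> z; rewrite !qmulE mulrA.
Qed.

Lemma qmul1 : left_id (qpi 1) qmul.
Proof. by elim/qpi_ind=> x; rewrite qmulE mul1r. Qed.

Lemma qmul1r : right_id (qpi 1) qmul.
Proof. by elim/qpi_ind=> x; rewrite qmulE mulr1. Qed.

Lemma qmulDl : left_distributive qmul qadd.
Proof.
elim/qpi_ind=> x; elim/qpi_ind=> y; elim/qpi_ind=> z.
by rewrite (qaddE x y) !qmulE qaddE mulrDl.
Qed.

Lemma qmulDr : right_distributive qmul qadd.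
Proof.
elim/qpi_ind=> x; elim/qpi_ind=> y; elim/qpi_ind=> z.
by rewrite (qaddE y z) !qmulE qaddE mulrDr.
Qed.

HB.instance Definition _ :=
  GRing.Zmodule_isPzRing.Build quot_alg qmulA qmul1 qmul1r qmulDl qmulDr.

Lemma qscaleA a b u : qscale a (qscale b u) = qscale (a * b) u.
Proof. by elim/qpi_ind: u => x; rewrite !qscaleE scalerA. Qed.

Lemma qscale1 : left_id 1 qscale.
Proof. by elim/qpi_ind=> x; rewrite qscaleE scale1r. Qed.

Lemma qscaleDr : right_distributive qscale +%R.
Proof.
move=> a; elim/qpi_ind=> x; elim/qpi_ind=> y.
by rewrite [_ + _]qaddE !qscaleE [RHS]qaddE scalerDr.
Qed.

Lemma qscaleDl u : {morph qscale^~ u : a b / a + b}.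
Proof.
by move=> a b; elim/qpi_ind: u => x; rewrite !qscaleE [RHS]qaddE scalerDl.
Qed.

HB.instance Definition _ :=
  GRing.Zmodule_isLmodule.Build R quot_alg qscaleA qscale1 qscaleDr qscaleDl.

Lemma qpiD : {morph qpi : x y / x + y}.
Proof. by move=> x y; rewrite [RHS]qaddE. Qed.

Lemma qpiN : {morph qpi : x / - x}.
Proof. by move=> x; rewrite [RHS]qoppE. Qed.

Lemma qpiM : {morph qpi : x y / x * y}.
Proof. by move=> x y; rewrite [RHS]qmulE. Qed.

Lemma qpi1 : qpi 1 = 1.
Proof. by []. Qed.

Lemma qpiZ a : {morph qpi : x / a *: x}.
Proof. by move=> x; rewrite [RHS]qscaleE. Qed.

End QuotientAlgebra.

(* O_q(M_n(k)) is qmat (q k) (qinv k) n: the free algebra on the x_ij modulo the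
   two-sided ideal generated by the differences of the two sides of the
   relations. The base ring and the elements t, tV standing for q, q^-1 are kept
   abstract in this section. *)
Section QuantumMatrices.
Variables (R : comNzRingType) (t tV : R) (n : nat).

Definition idx := {i : nat | 0 < i <= n}%N.

Definition free_alg := {malg R[{fmonom (idx * idx)%type}]}.
HB.instance Definition _ := GRing.Lalgebra.on free_alg.

Definition fgen (i j : idx) : free_alg := << fmu (i, j) >>.

Inductive qmat_rel : free_alg -> Prop :=
| qmat_row (i j l : idx) : (val j < val l)%N ->
    qmat_rel (fgen i j * fgen i l - tV *: (fgen i l * fgen i j))
| qmat_col (i j l : idx) : (val j < val l)%N ->
    qmat_rel (fgen j i * fgen l i - tV *: (fgen l i * fgen j i))
| qmat_anti (i j l m : idx) :
    (val i < val l)%N && (val j > val m)%N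
    || (val i > val l)%N && (val j < val m)%N ->
    qmat_rel (fgen i j * fgen l m - fgen l m * fgen i j)
| qmat_diag (i j l m : idx) : (val i < val l)%N -> (val j < val m)%N ->
    qmat_rel (fgen i j * fgen l m - fgen l m * fgen i j
              - (tV - t) *: (fgen l j * fgen i m)).

Definition qmat := quot_alg qmat_rel.
HB.instance Definition _ := GRing.PzRing.on qmat.
HB.instance Definition _ := GRing.Lmodule.on qmat.

(* 1 != 0 in the quotient: the constant coefficient kills every relation *)
Lemma mcoeff1_ideal (x : free_alg) : ideal_gen qmat_rel x -> mcoeff mone x = 0.
Proof.
have g0 i j : mcoeff mone (fgen i j) = 0.
  rewrite /fgen mcoeffU1; case: eqP => // /(congr1 (fun m => size (val m))).
  by rewrite fmuE /= fm1.
have cM (u v : free_alg) : mcoeff mone (u * v) = mcoeff mone u * mcoeff mone v.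
  by case: (@mcoeff1g_is_multiplicative {fmonom (idx * idx)%type} R).
have gg i j l m : mcoeff mone (fgen i j * fgen l m) = 0.
  by rewrite (cM (fgen i j)) (g0 i j) mul0r.
have B0 (u v : free_alg) :
    mcoeff mone u = 0 -> mcoeff mone v = 0 -> mcoeff mone (u - v) = 0.
  by rewrite mcoeffB => -> ->; rewrite subr0.
have Z0 a (u : free_alg) : mcoeff mone u = 0 -> mcoeff mone (a *: u) = 0.
  by rewrite mcoeffZ => ->; rewrite mulr0.
elim=> {x} [x|||] /=.
- case=> [i j l _|i j l _|i j l m _|i j l m _ _].
  + exact: B0 (gg i j i l) (Z0 _ _ (gg i l i j)).
  + exact: B0 (gg j i l i) (Z0 _ _ (gg l i j i)).
  + exact: B0 (gg i j l m) (gg l m i j).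
  + exact: B0 (B0 _ _ (gg i j l m) (gg l m i j)) (Z0 _ _ (gg l j i m)).
- by rewrite mcoeff0.
- by move=> x y _ x0 _ y0; rewrite mcoeffD x0 y0 addr0.
- by move=> a b x _ x0; rewrite (cM (a * x)) (cM a) x0 mulr0 mul0r.
Qed.

Lemma qmat1_neq0 : 1 != 0 :> qmat.
Proof.
apply/eqP => /qpiP/mcoeff1_ideal.
by rewrite subr0 rmorph1 => /eqP; rewrite oner_eq0.
Qed.

HB.instance Definition _ := GRing.PzSemiRing_isNonZero.Build qmat qmat1_neq0.

Lemma qmat_scalerAl (a : R) (u v : qmat) : a *: (u * v) = (a *: u) * v.
Proof.
elim/qpi_ind: u => x; elim/qpi_ind: v => y.
by rewrite -qpiM -!qpiZ -qpiM scalerAl.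
Qed.

HB.instance Definition _ :=
  GRing.Lmodule_isLalgebra.Build R qmat qmat_scalerAl.

Lemma malgC_central (a : R) (x : free_alg) :
  a%:MP * x = x * a%:MP :> free_alg.
Proof.
rewrite [x]monalgE mulr_sumr mulr_suml; apply: eq_bigr => m _.
by rewrite !malgM_def !fgmulUU mul1m mulm1 mulrC.
Qed.

Lemma qmat_scalerAr (a : R) (u v : qmat) : a *: (u * v) = u * (a *: v).
Proof.
elim/qpi_ind: u => x; elim/qpi_ind: v => y.
rewrite -qpiM -!qpiZ -qpiM; congr qpi.
by rewrite -!mul_malgC !mulrA malgC_central.
Qed.

HB.instance Definition _ :=
  GRing.Lalgebra_isAlgebra.Build R qmat qmat_scalerAr.

(* The generator x_ij for 1 <= i, j <= n; the value 0 outside this range is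
   never used *)
Definition qx (i j : nat) : qmat :=
  if (insub i, insub j) is (Some a, Some b) then qpi qmat_rel (fgen a b) else 0.

(* The number of inversions of a tuple *)
Definition tinv (S : seq nat) : nat :=
  (\sum_(a < size S) \sum_(b < size S | a < b) (nth 0 S a > nth 0 S b))%N.

(* Quantum minors; t = q, tV = q^-1, so (-q)^-l is (- tV) ^+ l. [minor_inc] is
   the defining sum for increasing tuples, [minor] its extension to tuples of
   distinct entries; they agree on increasing tuples by [minor_sorted]. *)
Definition minor_inc (A B : seq nat) : qmat :=
  \sum_(s : 'S_(size A))
    (- tV) ^+ tinv [seq val (s a) | a <- enum 'I_(size A)] *:
      \prod_(a < size A) qx (nth 0%N A a) (nth 0%N B (s a)).

Definition minor (A B : seq nat) : qmat :=
  (- tV) ^+ (tinv A + tinv B) *: minor_inc (sort leq A) (sort leq B).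

Lemma tinv_sorted (S : seq nat) : sorted leq S -> tinv S = 0%N.
Proof.
move=> sS; rewrite /tinv big1 // => a _; rewrite big1 // => b ltab.
apply/eqP; rewrite eqb0 -leqNgt.
by apply: (sorted_leq_nth leq_trans leqnn) => //; rewrite ?inE // ltnW.
Qed.

Lemma minor_sorted (A B : seq nat) :
  sorted leq A -> sorted leq B -> minor A B = minor_inc A B.
Proof.
move=> sA sB; rewrite /minor !tinv_sorted // expr0 scale1r.
by rewrite !(sorted_sort leq_trans).
Qed.

End QuantumMatrices.

Section Lists.
Local Open Scope nat_scope.

Definition increasing_in (n : nat) (S : seq nat) : bool :=
  sorted ltn S && all (fun x => 0 < x <= n) S.

Definition tcompl (n : nat) (S : seq nat) : seq nat :=
  [seq x <- iota 1 n | x \notin S].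

(* The transposition (m, m+1) *)
Definition adj (m x : nat) : nat :=
  if x == m then m.+1 else if x == m.+1 then m else x.

Definition tact (m : nat) (S : seq nat) : seq nat := map (adj m) S.

Definition col_top (n r : nat) : seq nat := iota (n - r).+1 r.
Definition row_top (r : nat) : seq nat := iota 1 r.

(* The j_p such that sigma_J = (j_p, j_p + 1) *)
Definition col_pivot (n : nat) (J : seq nat) : nat :=
  last 0 [seq u.1 | u <- zip J (rcons (behead J) n.+1) & 1 < u.2 - u.1].

(* The i_p - 1 such that sigma_I = (i_p, i_p - 1) *)
Definition row_pivot (I : seq nat) : nat :=
  (head 0 [seq u.2 | u <- zip (0 :: I) I & 1 < u.2 - u.1]).-1.

Fixpoint col_tower_rec (fuel n : nat) (J : seq nat) : seq nat :=
  if fuel is f.+1 then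
    if J == col_top n (size J) then [::]
    else col_pivot n J :: col_tower_rec f n (tact (col_pivot n J) J)
  else [::].

Fixpoint row_tower_rec (fuel : nat) (I : seq nat) : seq nat :=
  if fuel is f.+1 then
    if I == row_top (size I) then [::]
    else row_pivot I :: row_tower_rec f (tact (row_pivot I) I)
  else [::].

(* The standard towers, each transposition (m, m+1) being recorded as m, in the
   order sigma^c_M, ..., sigma^c_1 (resp. sigma^r_N, ..., sigma^r_1). Each step
   raises (resp. lowers) one entry of a tuple in {1..n} by one, so the fuel is
   not exhausted before the top is reached. *)
Definition col_tower (n : nat) (J : seq nat) : seq nat :=
  col_tower_rec (n * size J) n J.
Definition row_tower (n : nat) (I : seq nat) : seq nat :=
  row_tower_rec (n * size I) I.

(* An element (Z, W) of a list C_i *)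
Record entry := Entry
  { esign : int; eZ : seq nat; eZ' : seq nat; eW : seq nat; eW' : seq nat }.

Definition set_sign (e : int) (c : entry) : entry :=
  Entry e (eZ c) (eZ' c) (eW c) (eW' c).
Definition col_act (m : nat) (c : entry) : entry :=
  Entry (esign c) (eZ c) (eZ' c) (tact m (eW c)) (tact m (eW' c)).
Definition row_act (m : nat) (c : entry) : entry :=
  Entry (esign c) (tact m (eZ c)) (tact m (eZ' c)) (eW c) (eW' c).

Definition appears_before (a b : nat) (S : seq nat) : bool :=
  index a S < index b S.

Definition in_phi (m : nat) (c : entry) : bool :=
  appears_before m m.+1 (eW c ++ eW' c).
Definition in_psi (m : nat) (c : entry) : bool :=
  appears_before m.+1 m (eZ c ++ eZ' c).

(* C_i^{I_0, J_s}, for cs = [:: sigma^c_s; ...; sigma^c_1]. That C_i is empty for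
   i > s follows from the recursion, and the case i < 0 is the branch i = 0 of
   the inner match. *)
Fixpoint col_list (n r : nat) (cs : seq nat) (i : nat) : seq entry :=
  if cs is m :: cs' then
    [seq set_sign ((-1) ^+ i)%R c | c <-
      (if i is i'.+1 then [seq c <- col_list n r cs' i' | ~~ in_phi m c]
       else [::])
      ++ [seq col_act m c | c <- col_list n r cs' i]]
  else if i == 0 then
    [:: Entry 1 (row_top r) (tcompl n (row_top r))
                (col_top n r) (tcompl n (col_top n r))]
  else [::].

(* C_i^{I_t, J_M}, for cs = [:: sigma^c_M; ...; sigma^c_1]
   and rs = [:: sigma^r_t; ...; sigma^r_1] *)
Fixpoint row_list (n r : nat) (cs rs : seq nat) (i : nat) : seq entry :=
  if rs is m :: rs' then
    (if i is i'.+1 then [seq c <- row_list n r cs rs' i' | ~~ in_psi m c]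
     else [::])
    ++ [seq row_act m c | c <- row_list n r cs rs' i]
  else col_list n r cs i.

Definition Clist (n : nat) (I J : seq nat) (i : nat) : seq entry :=
  row_list n (size J) (col_tower n J) (row_tower n I) i.

End Lists.

Notation Oq k n := (qmat (q k) (qinv k) n).
Notation qminor k n := (@minor (laurent k) (q k) (qinv k) n).

(* Main.v *)
Require Import Defs.
From HB Require Import structures.
From mathcomp Require Import all_boot all_order all_algebra all_fingroup.
From mathcomp Require Import generic_quotient monalg zify.

Set Implicit Arguments.
Unset Strict Implicit.
Unset Printing Implicit Defensive.

Import GRing.Theory.
Local Open Scope ring_scope.

(** For each adjacent pair m, m+1 the algebra O_q(M_n) carries the operators E, F
    and K of U_q(sl_2), acting on the columns of the matrix of generators or on
    its rows: E and F are skew derivations exchanging x_im and x_i,m+1. They send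
    quantum minors to quantum minors, kill those containing both m and m+1, and
    on a product of two complementary minors
      F E ([Z,W] [Z',W']) = [Z,sW] [Z',sW'] + q^{-1} or q times [Z,W] [Z',W'],
    according to whether m comes before m+1 in (W,W') or not, where s = (m,m+1).
    Hence FE - q^{-1} (for columns) and FE - q (for rows) are the generator of a
    Hecke algebra and its inverse, and they realise exactly one step of the
    recursion defining the lists C_i. Each of them also maps the left hand side
    for one step of a tower to the left hand side for the next one. At the top of
    the two towers all generators in the two minors commute. *)

(** * Algebra morphisms out of the quantum matrix algebra *)

(** The obstacle is to define E and F on an algebra given by generators and relations. A skew
    derivation is the off-diagonal entry of a multiplicative map into triangular 2x2 matrices, so it
    exists as soon as the matrices assigned to the generators satisfy the relations. Transposing
    indices preserves the relations, so row operators are column operators for the transposed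
    generators. Minors, being sums over orderings of the column tuple, are not visibly symmetric, so
    the vanishing of E on minors containing both m and m+1 has one proof for columns and another for
    rows.

    The constants q^{-1} and q cancel the diagonal term exactly on phi, respectively psi. On the
    other elements there remains q - q^{-1} for columns and q^{-1} - q for rows: one more factor of
    the expansion variable, hence one more step in i, with a change of sign for columns only. The
    left hand side stays a single term because the pair m, m+1, read in the complement followed by
    the tuple, always stands in the order that phi or psi singles out. *)

Definition qmat_family (R S : nzRingType) (t tV : R) (f : R -> S)
    (g : nat -> nat -> S) : Prop :=
  [/\ forall i j l, (j < l)%N -> g i j * g i l = f tV * (g i l * g i j),
      forall i j l, (j < l)%N -> g j i * g l i = f tV * (g l i * g j i),
      forall i j l m, (i < l)%N -> (m < j)%N -> g i j * g l m = g l m * g i j &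
      forall i j l m, (i < l)%N -> (j < m)%N ->
        g i j * g l m - g l m * g i j = f (tV - t) * (g l j * g i m)].

(** Row and column relations are exchanged; the last relation survives because the two factors of
    its right hand side commute by the third one. *)
Lemma qmat_family_tr (R S : nzRingType) (t tV : R) (f : R -> S) g :
  qmat_family t tV f g -> qmat_family t tV f (fun i j => g j i).
Proof.
move=> [gr gc ga gd]; split=> // [i j l m il mj|i j l m il jm].
  by rewrite (ga m l j i).
by rewrite gd // (ga j l m i).
Qed.

(** Indices run over all natural numbers, so that no bounds have to be carried along. Each term of a
    relation involves every index of that relation, so a single index outside [p] annihilates all
    terms. *)
Lemma qmat_family_supported (R : comNzRingType) (A : algType R) (t tV : R)
    (p : pred nat) (x : nat -> nat -> A) :
    (forall i j, ~~ (p i && p j) -> x i j = 0) ->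
    (forall i j l, p i -> p j -> p l -> (j < l)%N ->
       x i j * x i l = tV *: (x i l * x i j)) ->
    (forall i j l, p i -> p j -> p l -> (j < l)%N ->
       x j i * x l i = tV *: (x l i * x j i)) ->
    (forall i j l m, p i -> p j -> p l -> p m -> (i < l)%N -> (m < j)%N ->
       x i j * x l m = x l m * x i j) ->
    (forall i j l m, p i -> p j -> p l -> p m -> (i < l)%N -> (j < m)%N ->
       x i j * x l m - x l m * x i j = (tV - t) *: (x l j * x i m)) ->
  qmat_family t tV (fun c => c%:A) x.
Proof.
move=> x0 xr xc xa xd; split.
- move=> i j l jl; rewrite mulr_algl.
  have [pi|/negPf pi] := boolP (p i); last by rewrite !(x0 i) ?pi // mul0r scaler0.
  have [pj|/negPf pj] := boolP (p j); last first.
    by rewrite (x0 i j) ?pj ?andbF // mul0r mulr0 scaler0.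
  have [pl|/negPf pl] := boolP (p l); last first.
    by rewrite (x0 i l) ?pl ?andbF // mul0r mulr0 scaler0.
  exact: xr.
- move=> i j l jl; rewrite mulr_algl.
  have [pi|/negPf pi] := boolP (p i); last by rewrite !(x0 _ i) ?pi ?andbF // mul0r scaler0.
  have [pj|/negPf pj] := boolP (p j); last by rewrite (x0 j i) ?pj // mul0r mulr0 scaler0.
  have [pl|/negPf pl] := boolP (p l); last by rewrite (x0 l i) ?pl // mul0r mulr0 scaler0.
  exact: xc.
- move=> i j l m il mj.
  have [pi|/negPf pi] := boolP (p i); last by rewrite !(x0 i _) ?pi // mul0r mulr0.
  have [pl|/negPf pl] := boolP (p l); last by rewrite !(x0 l _) ?pl // mul0r mulr0.
  have [pj|/negPf pj] := boolP (p j); last by rewrite !(x0 _ j) ?pj ?andbF // mul0r mulr0.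
  have [pm|/negPf pm] := boolP (p m); last by rewrite !(x0 _ m) ?pm ?andbF // mul0r mulr0.
  exact: xa.
- move=> i j l m il jm; rewrite mulr_algl.
  have [pi|/negPf pi] := boolP (p i); last first.
    by rewrite !(x0 i _) ?pi // mul0r !mulr0 subrr scaler0.
  have [pl|/negPf pl] := boolP (p l); last first.
    by rewrite !(x0 l _) ?pl // !mul0r !mulr0 subrr scaler0.
  have [pj|/negPf pj] := boolP (p j); last first.
    by rewrite !(x0 _ j) ?pj ?andbF // !mul0r !mulr0 subrr scaler0.
  have [pm|/negPf pm] := boolP (p m); last first.
    by rewrite !(x0 _ m) ?pm ?andbF // !mul0r !mulr0 subrr scaler0.
  exact: xd.
Qed.

(** * Universal property of the quantum matrix algebra *)

Section Lift.
Variables (R : comNzRingType) (t tV : R) (n : nat) (S : nzRingType).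
Variables (f : {rmorphism R -> S}) (g : nat -> nat -> S).
Hypothesis fg_comm : forall c i j, GRing.comm (f c) (g i j).
Hypothesis g_family : qmat_family t tV f g.

Local Notation Oq := (qmat t tV n).

Definition fmonom_eval (m : {fmonom (idx n * idx n)%type}) : S :=
  \prod_(p <- (m : seq _)) g (val p.1) (val p.2).

Fact fmonom_eval_mmorphism : mmorphism fmonom_eval.
Proof.
split=> [x y|]; first by rewrite /fmonom_eval fmM big_cat.
by rewrite /fmonom_eval fm1 big_nil.
Qed.

HB.instance Definition _ :=
  monalg.isMultiplicative.Build {fmonom (idx n * idx n)%type} S fmonom_eval
    fmonom_eval_mmorphism.

Definition free_lift (x : free_alg R n) : S := mmap f fmonom_eval x.

Lemma fmonom_eval_comm c m : GRing.comm (f c) (fmonom_eval m).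
Proof. by apply: commr_prod => p _; apply: fg_comm. Qed.

Lemma free_liftM x y : free_lift (x * y) = free_lift x * free_lift y.
Proof.
have [fM _] := commr_mmap_is_multiplicative
  (f := f) (h := fmonom_eval) (fun g m m' => fmonom_eval_comm _ _).
exact: fM.
Qed.

Lemma free_liftB x y : free_lift (x - y) = free_lift x - free_lift y.
Proof. exact: mmapB. Qed.

Lemma free_liftD x y : free_lift (x + y) = free_lift x + free_lift y.
Proof. exact: mmapD. Qed.

Lemma free_liftZ c x : free_lift (c *: x) = f c * free_lift x.
Proof. exact: mmapZ. Qed.

Lemma free_lift_gen i j : free_lift (fgen R i j) = g (val i) (val j).
Proof.
rewrite /free_lift mmapU.
transitivity (1 * fmonom_eval (fmu (i, j))).
  by congr (_ * _); exact: rmorph1.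
by rewrite mul1r /fmonom_eval fmU big_seq1.
Qed.

(* Rewriting with the morphism equations is avoided here: comparing two distinct
   products of [free_alg] makes unification unfold them completely. *)
Lemma free_lift_ideal x : ideal_gen (qmat_rel t tV (n := n)) x -> free_lift x = 0.
Proof.
have [gr gc ga gd] := g_family.
have gM i j l m : free_lift (fgen R i j * fgen R l m) =
    g (val i) (val j) * g (val l) (val m).
  apply: etrans (free_liftM _ _) _.
  by congr (_ * _); apply: free_lift_gen.
have fB u v a b : free_lift u = a -> free_lift v = b -> free_lift (u - v) = a - b.
  by move=> <- <-; apply: free_liftB.
have fZ c u a : free_lift u = a -> free_lift (c *: u) = f c * a.
  by move=> <-; apply: free_liftZ.
elim=> {x} [x|||] /=.
- case=> [i j l lt|i j l lt|i j l m lt|i j l m il jm].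
  + by apply: etrans (fB _ _ _ _ (gM _ _ _ _) (fZ _ _ _ (gM _ _ _ _))) _;
      rewrite gr ?subrr.
  + by apply: etrans (fB _ _ _ _ (gM _ _ _ _) (fZ _ _ _ (gM _ _ _ _))) _;
      rewrite gc ?subrr.
  + apply: etrans (fB _ _ _ _ (gM _ _ _ _) (gM _ _ _ _)) _.
    by case/orP: lt => /andP[il jm]; [rewrite ga|rewrite -ga]; rewrite ?subrr.
  + apply: etrans (fB _ _ _ _ (fB _ _ _ _ (gM _ _ _ _) (gM _ _ _ _))
                              (fZ _ _ _ (gM _ _ _ _))) _.
    by rewrite gd ?subrr.
- exact: mmap0.
- by move=> x y _ x0 _ y0; rewrite free_liftD x0 y0 addr0.
- by move=> a b x _ x0; rewrite !free_liftM x0 mulr0 mul0r.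
Qed.

(** Scalars enter through a ring morphism [f] whose values commute with the images of the
    generators. This form covers 2x2 matrices over an algebra, with [R] embedded as scalar
    matrices. *)
Definition qmat_lift (u : Oq) : S := free_lift (repr u).

Lemma qmat_lift_qpi x : qmat_lift (qpi _ x) = free_lift x.
Proof.
apply/eqP; rewrite -subr_eq0 -free_liftB; apply/eqP/free_lift_ideal.
exact: repr_qpi.
Qed.

Lemma qmat_liftD u v : qmat_lift (u + v) = qmat_lift u + qmat_lift v.
Proof.
elim/qpi_ind: u => x; elim/qpi_ind: v => y.
by rewrite -qpiD !qmat_lift_qpi free_liftD.
Qed.

Lemma qmat_liftM u v : qmat_lift (u * v) = qmat_lift u * qmat_lift v.
Proof.
elim/qpi_ind: u => x; elim/qpi_ind: v => y.
by rewrite -qpiM !qmat_lift_qpi free_liftM.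
Qed.

Lemma qmat_liftZ c u : qmat_lift (c *: u) = f c * qmat_lift u.
Proof. by elim/qpi_ind: u => x; rewrite -qpiZ !qmat_lift_qpi free_liftZ. Qed.

Lemma qmat_lift1 : qmat_lift 1 = 1.
Proof. by rewrite -qpi1 qmat_lift_qpi /free_lift mmap1. Qed.

Lemma qmat_lift_gen i j : (0 < i <= n)%N -> (0 < j <= n)%N ->
  qmat_lift (qx t tV n i j) = g i j.
Proof.
move=> hi hj; by rewrite /qx !insubT /= qmat_lift_qpi free_lift_gen.
Qed.

End Lift.

Lemma malgUZ (R : nzRingType) (K : monomType) (c : R) (m : K) :
  << c *g m >> = c *: << m >> :> {malg R[K]}.
Proof. by apply/malgP => l; rewrite mcoeffZ !mcoeffU mulrnAr mulr1. Qed.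

(** * Generators: induction principle and relations *)

Section Generators.
Variables (R : comNzRingType) (t tV : R) (n : nat).
Local Notation Oq := (qmat t tV n).
Local Notation x := (qx t tV n).

Lemma qx_out i j : ~~ ((0 < i <= n)%N && (0 < j <= n)%N) -> x i j = 0.
Proof.
rewrite negb_and /qx => /orP[] h; first by rewrite insubN.
by case: insub => // a; rewrite insubN.
Qed.

Lemma qx_inE i j (hi : (0 < i <= n)%N) (hj : (0 < j <= n)%N) :
  x i j = qpi (qmat_rel t tV (n := n)) (fgen R (exist _ i hi) (exist _ j hj)).
Proof.
rewrite /qx !insubT /=; congr qpi; congr fgen; exact: val_inj.
Qed.

(** Every element is a linear combination of words in the generators, so identities between linear
    multiplicative maps need only be checked on generators. *)
Lemma qmat_ind (P : Oq -> Prop) :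
    P 1 -> (forall u v, P u -> P v -> P (u + v)) ->
    (forall c u, P u -> P (c *: u)) ->
    (forall u v, P u -> P v -> P (u * v)) ->
    (forall i j, (0 < i <= n)%N -> (0 < j <= n)%N -> P (x i j)) ->
  forall u, P u.
Proof.
move=> P1 PD PZ PM Px.
have PqD u v : P (qpi _ u) -> P (qpi _ v) -> P (qpi _ (u + v)).
  by move=> Pu Pv; rewrite qpiD; apply: PD.
have PqZ c u : P (qpi _ u) -> P (qpi _ (c *: u)).
  by move=> Pu; rewrite qpiZ; apply: PZ.
have PqM u v : P (qpi _ u) -> P (qpi _ v) -> P (qpi _ (u * v)).
  by move=> Pu Pv; rewrite qpiM; apply: PM.
elim/qpi_ind=> u; rewrite [u]monalgE.
have P0 : P 0 by rewrite -(scale0r (1 : Oq)); apply: PZ.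
elim/big_rec: _ => [|m v _ Pv]; first exact: P0.
apply: PqD; last exact: Pv.
rewrite malgUZ; apply: PqZ; case: m => s; elim: s => [|[[i hi] [j hj]] s IH].
  have -> : FMonom [::] = mone :> {fmonom (idx n * idx n)%type}.
    by apply/eqP; rewrite fmP fm1.
  by rewrite -[<< _ >>]/(1 : free_alg R n) qpi1.
pose a : idx n := exist _ i hi; pose b : idx n := exist _ j hj.
have -> : FMonom ((a, b) :: s) = mmul (fmu (a, b)) (FMonom s).
  by apply/eqP; rewrite fmP fmM fmU.
have -> : << mmul (fmu (a, b)) (FMonom s) >> = fgen R a b * << FMonom s >>.
  by rewrite /fgen malgM_def fgmulUU mulr1.
apply: PqM IH.
by rewrite -qx_inE; apply: Px.
Qed.

Lemma qpi_rel u v : qmat_rel t tV (n := n) (u - v) ->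
  qpi (qmat_rel t tV (n := n)) u = qpi _ v.
Proof. by move=> uv; apply/qpiP/ideal_gen_in. Qed.

Local Notation pi := (qpi (qmat_rel t tV (n := n))).

Lemma qpiZM c u v : pi (c *: (u * v)) = c *: (pi u * pi v).
Proof. by rewrite qpiZ qpiM. Qed.

Lemma qpiBM u v u' v' : pi (u * v - u' * v') = pi u * pi v - pi u' * pi v'.
Proof.
have piB a b c d : pi a = c -> pi b = d -> pi (a - b) = c - d.
  by move=> <- <-; rewrite qpiD qpiN.
exact: piB (qpiM _ _ _) (qpiM _ _ _).
Qed.

Lemma qx_family : qmat_family t tV (fun c => c%:A) x.
Proof.
apply: (@qmat_family_supported _ _ _ _ (fun i => (0 < i <= n)%N)).
- exact: qx_out.
- move=> i j l hi hj hl jl; rewrite !qx_inE; apply: etrans (esym (qpiM _ _ _)) _.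
  have := @qmat_row _ t tV n (exist _ i hi) (exist _ j hj) (exist _ l hl) jl.
  by move/qpi_rel=> e; apply: (etrans e); apply: qpiZM.
- move=> i j l hi hj hl jl; rewrite !qx_inE; apply: etrans (esym (qpiM _ _ _)) _.
  have := @qmat_col _ t tV n (exist _ i hi) (exist _ j hj) (exist _ l hl) jl.
  by move/qpi_rel=> e; apply: (etrans e); apply: qpiZM.
- move=> i j l m hi hj hl hm il mj; rewrite !qx_inE.
  apply: etrans (esym (qpiM _ _ _)) _.
  have := @qmat_anti _ t tV n (exist _ i hi) (exist _ j hj)
    (exist _ l hl) (exist _ m hm).
  rewrite /= il mj => /(_ isT)/qpi_rel e; apply: (etrans e); exact: qpiM.
- move=> i j l m hi hj hl hm il jm; rewrite !qx_inE.
  apply: etrans (esym (qpiBM _ _ _ _)) _.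
  have := @qmat_diag _ t tV n (exist _ i hi) (exist _ j hj)
    (exist _ l hl) (exist _ m hm) il jm.
  by move/qpi_rel=> e; apply: (etrans e); apply: qpiZM.
Qed.

End Generators.

(** * The action of U_q(sl_2) *)

Section Triangular.
Variables (R : comNzRingType) (A : algType R).

(* Multiplicative maps into upper triangular matrices encode skew derivations:
   the off-diagonal entry is one, twisted by the two diagonal entries. *)
Definition tri (a b d : A) : 'M[A]_2 :=
  \matrix_(i < 2, j < 2)
    if i == 0 then if j == 0 then a else b else if j == 0 then 0 else d.

Definition tri_scalar : {rmorphism R -> 'M[A]_2} :=
  GRing.RMorphism.clone _ _ ((@scalar_mx A 2) \o (in_alg A)) _.

Lemma triM a b d a' b' d' :
  tri a b d * tri a' b' d' = tri (a * a') (a * b' + b * d') (d * d').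
Proof.
apply/matrixP => i j; rewrite !mxE !big_ord_recl big_ord0 !mxE /= addr0.
by case: i j => [] [|[|i]] // hi [] [|[|j]] // hj /=; rewrite ?mulr0 ?mul0r ?addr0 ?add0r.
Qed.

Lemma triD a b d a' b' d' :
  tri a b d + tri a' b' d' = tri (a + a') (b + b') (d + d').
Proof.
apply/matrixP => i j; rewrite !mxE.
by case: (i == 0); case: (j == 0); rewrite ?addr0.
Qed.

Lemma triN a b d : - tri a b d = tri (- a) (- b) (- d).
Proof.
apply/matrixP => i j; rewrite !mxE.
by case: (i == 0); case: (j == 0); rewrite ?oppr0.
Qed.

Lemma tri_scalarE c : tri_scalar c = tri c%:A 0 c%:A.
Proof.
apply/matrixP => i j; rewrite !mxE.
by case: i j => [] [|[|i]] // hi [] [|[|j]] // hj.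
Qed.

Lemma tri_scalarM c a b d :
  tri_scalar c * tri a b d = tri (c *: a) (c *: b) (c *: d).
Proof. by rewrite tri_scalarE triM !mulr_algl mul0r addr0. Qed.

Lemma tri_scalar_comm c a b d : GRing.comm (tri_scalar c) (tri a b d).
Proof.
by rewrite /GRing.comm tri_scalarM tri_scalarE triM !mulr_algr mulr0 add0r.
Qed.

(** A relation between triangular matrices splits into its entries: the diagonal ones are the
    relations for [x] and [z], and the four remaining hypotheses are the off-diagonal ones. *)
Lemma tri_family (t tV : R) (x y z : nat -> nat -> A) :
    qmat_family t tV (fun c => c%:A) x -> qmat_family t tV (fun c => c%:A) z ->
    (forall i j l, (j < l)%N -> x i j * y i l + y i j * z i l =
       tV *: (x i l * y i j + y i l * z i j)) ->
    (forall i j l, (j < l)%N -> x j i * y l i + y j i * z l i =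
       tV *: (x l i * y j i + y l i * z j i)) ->
    (forall i j l m, (i < l)%N -> (m < j)%N ->
       x i j * y l m + y i j * z l m = x l m * y i j + y l m * z i j) ->
    (forall i j l m, (i < l)%N -> (j < m)%N ->
       x i j * y l m + y i j * z l m - (x l m * y i j + y l m * z i j) =
       (tV - t) *: (x l j * y i m + y l j * z i m)) ->
  qmat_family t tV tri_scalar (fun i j => tri (x i j) (y i j) (z i j)).
Proof.
move=> [xr xc xa xd] [zr zc za zd] yr yc ya yd; split.
- by move=> i j l lt; rewrite !triM tri_scalarM xr // zr // yr // !mulr_algl.
- by move=> i j l lt; rewrite !triM tri_scalarM xc // zc // yc // !mulr_algl.
- by move=> i j l m il mj; rewrite !triM xa // za // ya.
- move=> i j l m il jm.
  by rewrite !triM triN triD tri_scalarM xd // zd // yd // !mulr_algl.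
Qed.

(** In each relation all terms use the same two columns, so both sides are multiplied by the same
    product of weights. *)
Lemma scaled_family (t tV : R) (w : nat -> R) (x : nat -> nat -> A) :
    qmat_family t tV (fun c => c%:A) x ->
  qmat_family t tV (fun c => c%:A) (fun i j => w j *: x i j).
Proof.
have wM j l a b : (w j *: a) * (w l *: b) = (w j * w l) *: (a * b) :> A.
  by rewrite -scalerAl -scalerAr scalerA.
move=> [xr xc xa xd]; split.
- move=> i j l lt; rewrite !wM xr // !mulr_algl !scalerA.
  by rewrite mulrC (mulrC (w j)).
- by move=> i j l lt; rewrite !wM xc // !mulr_algl !scalerA mulrC.
- by move=> i j l m il mj; rewrite !wM xa // (mulrC (w j)).
- move=> i j l m il jm; rewrite !wM (mulrC (w m)) -scalerBr xd // !mulr_algl.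
  by rewrite !scalerA mulrC.
Qed.

End Triangular.

Variant adj_spec (m j : nat) : bool -> bool -> Type :=
| AdjLow of j = m : adj_spec m j true false
| AdjHigh of j = m.+1 : adj_spec m j false true
| AdjOther of j != m & j != m.+1 : adj_spec m j false false.

Lemma adjP m j : adj_spec m j (j == m) (j == m.+1).
Proof.
have [->|nm] := eqVneq j m; first by rewrite ltn_eqF //; constructor.
by have [->|nm1] := eqVneq j m.+1; constructor.
Qed.

Section Chevalley.
Variables (R : comNzRingType) (A : algType R) (t tV : R) (m : nat).
Hypothesis t_inv : t * tV = 1.

(** Eigenvalues of K on the columns of generators; [wtV] lists those of the inverse of K. [lower]
    and [raise] are the values of E and F on generators. *)
Definition wt (j : nat) : R := if j == m then t else if j == m.+1 then tV else 1.
Definition wtV (j : nat) : R := if j == m then tV else if j == m.+1 then t else 1.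
Definition lower (x : nat -> nat -> A) i j := if j == m.+1 then x i m else 0.
Definition raise (x : nat -> nat -> A) i j := if j == m then x i m.+1 else 0.

Local Notation fam := (qmat_family t tV (fun c : R => c%:A : A)).

Ltac adj_cases j := case: (adjP m j) => [?|?|? ?]; try subst j.
Ltac adj_simp := rewrite /= ?mulr0 ?mul0r ?addr0 ?add0r ?scaler0 ?scale1r
   -?scalerAr -?scalerAl ?scalerA ?mulr1 ?oppr0.

Lemma lower_family (x : nat -> nat -> A) : fam x ->
  qmat_family t tV (tri_scalar A)
    (fun i j => tri (x i j) (lower x i j) (wt j *: x i j)).
Proof.
move=> xf; have [xr0 xc0 xa xd0] := xf.
have xr i j l : (j < l)%N -> x i j * x i l = tV *: (x i l * x i j).
  by move=> lt; rewrite -mulr_algl xr0.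
have xc i j l : (j < l)%N -> x j i * x l i = tV *: (x l i * x j i).
  by move=> lt; rewrite -mulr_algl xc0.
have xd i j l p : (i < l)%N -> (j < p)%N ->
    x i j * x l p = x l p * x i j + (tV - t) *: (x l j * x i p).
  by move=> il jp; rewrite -mulr_algl -xd0 // addrC subrK.
apply: tri_family => //; first exact: scaled_family.
{ move=> i j l jl; rewrite /lower /wt.
  adj_cases j; adj_cases l; try lia; adj_simp => //; try (apply: xr; lia).
  by rewrite mulrC t_inv scale1r. }
{ move=> i j l jl; rewrite /lower /wt.
  adj_cases i; adj_simp => //.
  (* Two generators of column m+1. After reordering, the coefficients of [x l m * x j m.+1] agree
     because 1 + q^{-1} (q^{-1} - q) = q^{-2}. *)
  rewrite (xd j m l m.+1) // (xa j m.+1 l m) // !scalerDr !scalerA addrCA.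
  congr (_ + _); rewrite -[X in X + _]scale1r -scalerDl mulrBr (mulrC tV t) t_inv.
  by rewrite addrC subrK. }
{ move=> i j l p il pj; rewrite /lower /wt.
  adj_cases j; adj_cases p; try lia; adj_simp => //; try (apply: xa; lia).
  by rewrite (xc _ i l) // scalerA t_inv scale1r. }
{ move=> i j l p il jp; rewrite /lower /wt.
  adj_cases j; adj_cases p; try lia; adj_simp => //;
    try (by rewrite subrr); try (rewrite -mulr_algl; apply: xd0; lia).
  by rewrite (xc _ i l) // -scalerBl. }
Qed.

Lemma raise_family (x : nat -> nat -> A) : fam x ->
  qmat_family t tV (tri_scalar A)
    (fun i j => tri (wtV j *: x i j) (raise x i j) (x i j)).
Proof.
move=> xf; have [xr0 xc0 xa xd0] := xf.
have xr i j l : (j < l)%N -> x i j * x i l = tV *: (x i l * x i j).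
  by move=> lt; rewrite -mulr_algl xr0.
have xc i j l : (j < l)%N -> x j i * x l i = tV *: (x l i * x j i).
  by move=> lt; rewrite -mulr_algl xc0.
have xd i j l p : (i < l)%N -> (j < p)%N ->
    x i j * x l p = x l p * x i j + (tV - t) *: (x l j * x i p).
  by move=> il jp; rewrite -mulr_algl -xd0 // addrC subrK.
apply: tri_family => //; first exact: scaled_family.
{ move=> i j l jl; rewrite /raise /wtV.
  adj_cases j; adj_cases l; try lia; adj_simp => //; try (apply: xr; lia).
  by rewrite mulrC t_inv scale1r. }
{ move=> i j l jl; rewrite /raise /wtV.
  adj_cases i; adj_simp => //.
  rewrite (xd j m l m.+1) // (xa j m.+1 l m) // [LHS]addrC [in RHS]addrC
    !scalerDr !scalerA addrCA.
  congr (_ + _); rewrite -[X in X + _]scale1r -scalerDl mulrBr (mulrC tV t) t_inv.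
  by rewrite addrC subrK. }
{ move=> i j l p il pj; rewrite /raise /wtV.
  adj_cases j; adj_cases p; try lia; adj_simp => //; try (apply: xa; lia).
  by rewrite (xc _ i l) // scalerA t_inv scale1r. }
{ move=> i j l p il jp; rewrite /raise /wtV.
  adj_cases j; adj_cases p; try lia; adj_simp => //;
    try (by rewrite subrr); try (rewrite -mulr_algl; apply: xd0; lia).
  by rewrite (xc _ i l) // -scalerBl. }
Qed.
End Chevalley.

Lemma additive_zero (U V : zmodType) (f : U -> V) :
  (forall u v, f (u + v) = f u + f v) -> f 0 = 0.
Proof. by move=> fD; apply: (addrI (f 0)); rewrite -fD !addr0. Qed.

Record skew_derivation (R : comNzRingType) (A B : algType R) (f d g : B -> A) :
    Prop := SkewDerivation {
  skewlD : forall u v, f (u + v) = f u + f v;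
  skewlZ : forall c u, f (c *: u) = c *: f u;
  skewlM : forall u v, f (u * v) = f u * f v;
  skewl1 : f 1 = 1;
  skewD : forall u v, d (u + v) = d u + d v;
  skewZ : forall c u, d (c *: u) = c *: d u;
  skewM : forall u v, d (u * v) = f u * d v + d u * g v;
  skew1 : d 1 = 0;
  skewrD : forall u v, g (u + v) = g u + g v;
  skewrZ : forall c u, g (c *: u) = c *: g u;
  skewrM : forall u v, g (u * v) = g u * g v;
  skewr1 : g 1 = 1 }.

Lemma triK (R : comNzRingType) (A : algType R) (M : 'M[A]_2) :
  M 1 0 = 0 -> M = tri (M 0 0) (M 0 1) (M 1 1).
Proof.
move=> M0; apply/matrixP=> i j; rewrite !mxE.
case: i j => [] [|[|i]] // hi [] [|[|j]] // hj /=.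
- by congr (M _ _); apply: val_inj.
- by congr (M _ _); apply: val_inj.
- by rewrite -[RHS]M0; congr (M _ _); apply: val_inj.
- by congr (M _ _); apply: val_inj.
Qed.

Lemma tri_low0M (R : comNzRingType) (A : algType R) (M N : 'M[A]_2) :
  M 1 0 = 0 -> N 1 0 = 0 -> (M * N) 1 0 = 0.
Proof. by move=> /triK -> /triK ->; rewrite triM mxE. Qed.

Lemma skew_derivation_tri (R : comNzRingType) (A B : algType R)
    (h : B -> 'M[A]_2) :
    (forall u v, h (u + v) = h u + h v) ->
    (forall u v, h (u * v) = h u * h v) ->
    (forall c u, h (c *: u) = tri_scalar A c * h u) -> h 1 = 1 ->
    (forall u, h u 1 0 = 0) ->
  skew_derivation (fun u => h u 0 0) (fun u => h u 0 1) (fun u => h u 1 1).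
Proof.
move=> hD hM hZ h1 h0.
have trih u : h u = tri (h u 0 0) (h u 0 1) (h u 1 1) by apply: triK.
have hM' u v : h (u * v) = tri (h u 0 0 * h v 0 0)
    (h u 0 0 * h v 0 1 + h u 0 1 * h v 1 1) (h u 1 1 * h v 1 1).
  by rewrite hM (trih u) (trih v) triM !mxE.
have hZ' c u : h (c *: u) = tri (c *: h u 0 0) (c *: h u 0 1) (c *: h u 1 1).
  by rewrite hZ {1}(trih u) tri_scalarM.
by split=> *; rewrite ?hD ?hM' ?hZ' ?h1 ?mxE.
Qed.

(** The matrices assigned to generators extend to a morphism into all 2x2 matrices. Its lower left
    entry vanishes on generators, hence everywhere by induction, and the other three entries are the
    maps sought. *)
Lemma skew_derivation_lift (R : comNzRingType) (t tV : R) (n : nat)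
    (a b d : nat -> nat -> qmat t tV n) :
    qmat_family t tV (tri_scalar (qmat t tV n))
      (fun i j => tri (a i j) (b i j) (d i j)) ->
  exists fa fb fd : qmat t tV n -> qmat t tV n,
    skew_derivation fa fb fd /\
    forall i j, (0 < i <= n)%N -> (0 < j <= n)%N ->
      [/\ fa (qx t tV n i j) = a i j, fb (qx t tV n i j) = b i j &
          fd (qx t tV n i j) = d i j].
Proof.
set g := fun _ => _ => gf.
have gc c i j : GRing.comm (tri_scalar (qmat t tV n) c) (g i j).
  exact: tri_scalar_comm.
pose h : qmat t tV n -> _ := qmat_lift (tri_scalar (qmat t tV n)) g.
have hD : forall u v, h (u + v) = h u + h v by exact: qmat_liftD.
have hM : forall u v, h (u * v) = h u * h v by exact: qmat_liftM.
have hZ : forall c u, h (c *: u) = tri_scalar _ c * h u by exact: qmat_liftZ.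
have h1 : h 1 = 1 by exact: qmat_lift1.
have hx i j : (0 < i <= n)%N -> (0 < j <= n)%N -> h (qx t tV n i j) = g i j.
  exact: qmat_lift_gen.
(* From here on [h] is known only through its morphism equations and its values on generators. *)
move: h hD hM hZ h1 hx => h hD hM hZ h1 hx.
have h0 u : h u 1 0 = 0.
  move: u; apply: qmat_ind => [|u v|c u|u v|i j hi hj].
  - by rewrite h1 mxE.
  - by rewrite hD mxE => -> ->; rewrite addr0.
  - by move=> u0; rewrite hZ; apply: tri_low0M => //; rewrite tri_scalarE mxE.
  - by move=> u0 v0; rewrite hM; apply: tri_low0M.
  - by rewrite hx // mxE.
exists (fun u => h u 0 0), (fun u => h u 0 1), (fun u => h u 1 1).
split; first exact: skew_derivation_tri.
by move=> i j hi hj; rewrite hx // !mxE.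
Qed.

(** The operators always act on the second index; exchanging the indices turns that index into the
    row, so rows and columns share one construction. *)
Definition orient (T : Type) (rows : bool) (x : nat -> nat -> T) i j : T :=
  if rows then x j i else x i j.

Lemma orient_family (R S : nzRingType) (t tV : R) (f : R -> S) rows g :
  qmat_family t tV f g -> qmat_family t tV f (orient rows g).
Proof. by case: rows => // gf; apply: qmat_family_tr. Qed.

Lemma orientK (T : Type) rows (x : nat -> nat -> T) :
  orient rows (orient rows x) = x.
Proof. by case: rows. Qed.

(** The skew Leibniz rules are the coproducts of U_q(sl_2): E goes to 1 ⊗ E + E ⊗ K and F to K^{-1}
    ⊗ F + F ⊗ 1. [KV] plays the role of K^{-1}. *)
Record chevalley (R : comNzRingType) (A : algType R) (t tV : R) (m : nat)
    (y : nat -> nat -> A) (E F K KV : A -> A) : Prop := Chevalley {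
  chevE : skew_derivation id E K;
  chevF : skew_derivation KV F id;
  chevEx : forall i j, E (y i j) = lower m y i j;
  chevKx : forall i j, K (y i j) = wt t tV m j *: y i j;
  chevFx : forall i j, F (y i j) = raise m y i j;
  chevKVx : forall i j, KV (y i j) = wtV t tV m j *: y i j }.

Lemma skew_derivation_eql (R : comNzRingType) (A B : algType R)
    (f f' d g : B -> A) : f =1 f' ->
  skew_derivation f d g -> skew_derivation f' d g.
Proof. by move=> ff' [*]; split=> *; rewrite -?ff'. Qed.

Lemma skew_derivation_eqr (R : comNzRingType) (A B : algType R)
    (f d g g' : B -> A) : g =1 g' ->
  skew_derivation f d g -> skew_derivation f d g'.
Proof. by move=> gg' [*]; split=> *; rewrite -?gg'. Qed.

Lemma qmat_endo_id (R : comNzRingType) (t tV : R) (n : nat)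
    (f : qmat t tV n -> qmat t tV n) :
    (forall u v, f (u + v) = f u + f v) -> (forall c u, f (c *: u) = c *: f u) ->
    (forall u v, f (u * v) = f u * f v) -> f 1 = 1 ->
    (forall i j, (0 < i <= n)%N -> (0 < j <= n)%N ->
       f (qx t tV n i j) = qx t tV n i j) ->
  f =1 id.
Proof.
move=> fD fZ fM f1 fx; apply: qmat_ind => [|u v|c u|u v|i j hi hj].
- exact: f1.
- by rewrite fD => -> ->.
- by rewrite fZ => ->.
- by rewrite fM => -> ->.
- exact: fx.
Qed.

Section QmatChevalley.
Variables (R : comNzRingType) (t tV : R) (n m : nat) (rows : bool).
Hypotheses (t_inv : t * tV = 1) (m_gt0 : (0 < m)%N) (m_ltn : (m < n)%N).

Local Notation x := (qx t tV n).
Local Notation y := (orient rows x).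

Lemma qx_extend (f : qmat t tV n -> qmat t tV n) (g : nat -> nat -> qmat t tV n) :
    f 0 = 0 ->
    (forall i j, ~~ ((0 < i <= n)%N && (0 < j <= n)%N) -> g i j = 0) ->
    (forall i j, (0 < i <= n)%N -> (0 < j <= n)%N ->
       f (x i j) = orient rows g i j) ->
  forall i j, f (y i j) = g i j.
Proof.
move=> f0 g0 fx i j.
have [/andP[hi hj]|nij] := boolP ((0 < i <= n)%N && (0 < j <= n)%N).
  by move: fx; rewrite /orient; case: rows => fx; apply: fx.
rewrite g0 // /orient; case: rows; last by rewrite qx_out.
by rewrite qx_out // andbC.
Qed.

Lemma qmat_chevalley : exists E F K KV, chevalley t tV m y E F K KV.
Proof.
have yf : qmat_family t tV (fun c => c%:A) y by apply/orient_family/qx_family.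
have y0 i j : ~~ ((0 < i <= n)%N && (0 < j <= n)%N) -> y i j = 0.
  by rewrite /orient; case: rows => ?; rewrite qx_out // andbC.
have := orient_family rows (lower_family m t_inv yf).
have := orient_family rows (raise_family m t_inv yf).
have oT a b d : orient rows (fun i j => tri (a i j) (b i j) (d i j)) =
    (fun i j => tri (orient rows a i j) (orient rows b i j) (orient rows d i j)).
  by rewrite /orient; case: rows.
rewrite !oT.
move=> /skew_derivation_lift[KV [F [G [dF gF]]]].
move=> /skew_derivation_lift[H [E [K [dE gE]]]].
(* The lift produces the trivial diagonal entry only as an endomorphism. It fixes the generators, so
   it is the identity; the same holds for [H]. *)
have G1 : G =1 id.
  apply: qmat_endo_id; [exact: skewrD dF|exact: skewrZ dF|exact: skewrM dF|
    exact: skewr1 dF|].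
  by move=> i j hi hj; have [_ _ ->] := gF i j hi hj; rewrite orientK.
have H1 : H =1 id.
  apply: qmat_endo_id; [exact: skewlD dE|exact: skewlZ dE|exact: skewlM dE|
    exact: skewl1 dE|].
  by move=> i j hi hj; have [-> _ _] := gE i j hi hj; rewrite orientK.
exists E, F, K, KV; split.
- exact: skew_derivation_eql H1 dE.
- exact: skew_derivation_eqr G1 dF.
- apply: qx_extend => [|i j nij|i j hi hj]; last by case: (gE i j hi hj).
  + exact: additive_zero (skewD dE).
  (* Columns m and m+1 both lie in the range, so an index pair with j = m+1 can be out of range only
     through i, and then [y i m] vanishes too. *)
  + by rewrite /lower; case: eqP => // jm; apply: y0;
      move: nij; rewrite jm m_gt0 m_ltn (ltnW m_ltn).
- apply: qx_extend => [|i j nij|i j hi hj]; last by case: (gE i j hi hj).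
  + exact: additive_zero (skewrD dE).
  + by rewrite y0 // scaler0.
- apply: qx_extend => [|i j nij|i j hi hj]; last by case: (gF i j hi hj).
  + exact: additive_zero (skewD dF).
  + by rewrite /raise; case: eqP => // jm; apply: y0;
      move: nij; rewrite jm m_gt0 m_ltn (ltnW m_ltn).
- apply: qx_extend => [|i j nij|i j hi hj]; last by case: (gF i j hi hj).
  + exact: additive_zero (skewlD dF).
  + by rewrite y0 // scaler0.
Qed.

End QmatChevalley.

(** * Inversions and words *)

Section AdjacentTranspositions.
Local Open Scope nat_scope.
Implicit Types (S : seq nat) (m j : nat).

Lemma adjK m : involutive (adj m).
Proof.
by move=> j; rewrite /adj; case: (adjP m j) => [?|?|? ?]; subst;
  do ?case: eqP => //; lia.
Qed.

Lemma tactK m : involutive (tact m).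
Proof. by move=> S; rewrite /tact -map_comp map_id_in // => j _; apply: adjK. Qed.

Lemma size_tact m S : size (tact m S) = size S.
Proof. exact: size_map. Qed.

Lemma tact_uniq m S : uniq (tact m S) = uniq S.
Proof. exact/map_inj_uniq/inv_inj/adjK. Qed.

Lemma mem_tact m S j : (j \in tact m S) = (adj m j \in S).
Proof. by rewrite -{1}(adjK m j) mem_map //; apply/inv_inj/adjK. Qed.

Lemma adj_low m : adj m m = m.+1.
Proof. by rewrite /adj eqxx. Qed.

Lemma adj_high m : adj m m.+1 = m.
Proof. by rewrite /adj gtn_eqF ?eqxx. Qed.

Lemma tact_id m S : m \notin S -> m.+1 \notin S -> tact m S = S.
Proof.
move=> mS m1S; apply: map_id_in => j jS.
rewrite /adj; case: (adjP m j) => // jm; [by rewrite -jm jS in mS|by rewrite -jm jS in m1S].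
Qed.

Lemma tinv_cons j S : tinv (j :: S) = count (fun i => i < j) S + tinv S.
Proof.
rewrite /tinv /= big_ord_recl /=; congr (_ + _).
  rewrite big_mkcond big_ord_recl /= add0n.
  elim: S => [|i S IH]; first by rewrite big_ord0.
  by rewrite big_ord_recl /= -IH.
apply: eq_bigr => a _; rewrite big_mkcond big_ord_recl /= add0n.
by rewrite [RHS]big_mkcond.
Qed.

(** No integer lies strictly between m and m+1, so exchanging these two values changes no comparison
    with another entry. Only the pair m, m+1 itself can gain or lose an inversion. *)
Lemma tinv_tact m S : uniq S -> ~~ ((m \in S) && (m.+1 \in S)) ->
  tinv (tact m S) = tinv S.
Proof.
elim: S => [//|j S IH] /andP[jS uS] nb; rewrite /= !tinv_cons IH //; last first.
  by apply: contra nb; rewrite !inE => /andP[-> ->]; rewrite !orbT.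
congr (_ + _); rewrite count_map; apply: eq_in_count => i iS /=.
move: nb; rewrite !inE /adj; case: (adjP m j) => [?|?|? ?];
  case: (adjP m i) => [?|?|? ?]; subst=> //=; rewrite ?iS ?orbT ?andbT //; lia.
Qed.

Lemma tinv_tact_both m S : uniq S -> m \in S -> m.+1 \in S ->
  appears_before m m.+1 S -> tinv (tact m S) = (tinv S).+1.
Proof.
rewrite /appears_before.
elim: S => [//|j S IH] /andP[jS uS]; rewrite /= !inE !tinv_cons.
rewrite ![_ == j]eq_sym; case: (adjP m j) => [?|?|nm nm1].
- subst j => _ /= m1S _.
  rewrite tinv_tact ?(negPf jS) // -addSn; congr (_ + _).
  rewrite adj_low count_map.
  rewrite (seq.permP (perm_to_rem m1S)) [in RHS](seq.permP (perm_to_rem m1S)) /=.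
  rewrite adj_high ltnS leqnn ltnNge leqnSn /= add1n add0n; congr _.+1.
  apply: eq_in_count => i; rewrite mem_rem_uniq // inE /= => /andP[im1 iS].
  have im : i != m by apply: contraNneq jS => <-.
  by rewrite /adj (negPf im) (negPf im1) ltnS ltn_neqAle im.
- by subst j => _ _ /=; rewrite ltn0.
- move=> /= mS m1S lt; rewrite IH // addnS; congr (_ + _).+1.
  rewrite count_map; apply: eq_in_count => i iS /=.
  rewrite /adj (negPf nm) (negPf nm1).
  by case: (adjP m i) => [?|?|? ?]; subst=> //=; lia.
Qed.

Lemma tinv_swap (s1 s2 : seq nat) i j : i < j ->
  tinv (s1 ++ j :: i :: s2) = (tinv (s1 ++ i :: j :: s2)).+1.
Proof.
move=> ij; elim: s1 => [|h s1 IH] /=.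
  by rewrite !tinv_cons /= ij (ltnNge j) (ltnW ij) /=; lia.
by rewrite !tinv_cons IH addnS !count_cat /= (addnCA (i < h)).
Qed.

End AdjacentTranspositions.

(** * E, F and K on words in the generators *)

Section Words.
Variables (R : comNzRingType) (A : algType R) (t tV : R) (m : nat).
Variables (y : nat -> nat -> A) (E F K KV : A -> A).
Hypothesis chev : chevalley t tV m y E F K KV.

Definition word (L : seq (nat * nat)) : A := \prod_(p <- L) y p.1 p.2.
Definition map2nd (f : nat -> nat) (L : seq (nat * nat)) := [seq (p.1, f p.2) | p <- L].
(** Describes the result of E on a word containing both m and m+1: the lowered letter becomes a
    second m. *)
Definition collapse (j : nat) := if j == m.+1 then m else j.

Lemma word_cons p L : word (p :: L) = y p.1 p.2 * word L.
Proof. by rewrite /word big_cons. Qed.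

Lemma word_nil : word [::] = 1.
Proof. by rewrite /word big_nil. Qed.

Let EM := skewM (chevE chev).
Let E1 := skew1 (chevE chev).
Let KM := skewrM (chevE chev).
Let K1 := skewr1 (chevE chev).
Let FM := skewM (chevF chev).
Let F1 := skew1 (chevF chev).
Let KVM := skewlM (chevF chev).
Let KV1 := skewl1 (chevF chev).
Let Ex := chevEx chev.
Let Fx := chevFx chev.
Let Kx := chevKx chev.
Let KVx := chevKVx chev.

Lemma lower_word0 L : m.+1 \notin unzip2 L -> E (word L) = 0.
Proof.
elim: L => [|[i j] L IH] /=; first by rewrite word_nil E1.
rewrite inE negb_or => /andP[jm mL].
by rewrite word_cons EM IH // Ex /lower eq_sym (negPf jm) mulr0 mul0r addr0.
Qed.

Lemma raise_word0 L : m \notin unzip2 L -> F (word L) = 0.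
Proof.
elim: L => [|[i j] L IH] /=; first by rewrite word_nil F1.
rewrite inE negb_or => /andP[jm mL].
by rewrite word_cons FM IH // Fx /raise eq_sym (negPf jm) mulr0 mul0r addr0.
Qed.

Lemma weight_word1 L : m \notin unzip2 L -> m.+1 \notin unzip2 L ->
  K (word L) = word L.
Proof.
elim: L => [|[i j] L IH] /=; first by rewrite word_nil K1.
rewrite !inE !negb_or => /andP[jm mL] /andP[jm1 m1L].
by rewrite word_cons KM IH // Kx /wt /= ![j == _]eq_sym (negPf jm) (negPf jm1) scale1r.
Qed.

Lemma weight_word_low L : uniq (unzip2 L) -> m \in unzip2 L -> m.+1 \notin unzip2 L ->
  K (word L) = t *: word L.
Proof.
elim: L => [//|[i j] L IH] /= /andP[jL uL].
rewrite !inE !negb_or word_cons KM Kx /wt ![_ == j]eq_sym.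
case: (adjP m j) => [?|//|? ?] /=; first subst j.
  by move=> _ m1L; rewrite weight_word1 // scalerAl.
by move=> mL m1L; rewrite IH // scale1r scalerAr.
Qed.

Lemma weightV_word_low L : uniq (unzip2 L) -> m \in unzip2 L -> m.+1 \notin unzip2 L ->
  KV (word L) = tV *: word L.
Proof.
have KV1' L' : m \notin unzip2 L' -> m.+1 \notin unzip2 L' -> KV (word L') = word L'.
  elim: L' => [|[i j] L' IH] /=; first by rewrite word_nil KV1.
  rewrite !inE !negb_or => /andP[jm mL] /andP[jm1 m1L].
  by rewrite word_cons KVM IH // KVx /wtV /= ![j == _]eq_sym (negPf jm) (negPf jm1) scale1r.
elim: L => [//|[i j] L IH] /= /andP[jL uL].
rewrite !inE !negb_or word_cons KVM KVx /wtV ![_ == j]eq_sym.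
case: (adjP m j) => [?|//|? ?] /=; first subst j.
  by move=> _ m1L; rewrite KV1' // scalerAl.
by move=> mL m1L; rewrite IH // scale1r scalerAr.
Qed.

Lemma map2nd_id f L : (forall j, j \in unzip2 L -> f j = j) -> map2nd f L = L.
Proof.
move=> fL; apply: map_id_in => -[i j] ijL /=; rewrite fL //.
by apply/mapP; exists (i, j).
Qed.

(** Since second indices are distinct, E changes a single letter, and K is trivial on the letters to
    its right because m does not occur. *)
Lemma lower_word L : uniq (unzip2 L) -> m \notin unzip2 L -> m.+1 \in unzip2 L ->
  E (word L) = word (map2nd (adj m) L).
Proof.
elim: L => [//|[i j] L IH] /= /andP[jL uL].
rewrite !inE !negb_or !word_cons EM Ex /lower ![_ == j]eq_sym /adj /=.
case: (adjP m j) => [//|?|? ?] /=; first subst j.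
  move=> mL _; rewrite lower_word0 // weight_word1 // mulr0 add0r.
  congr (_ * word _); rewrite map2nd_id // => j jL'.
  rewrite /adj; case: (adjP m j) => // ?; subst j; first by rewrite jL' in mL.
  by rewrite jL' in jL.
by move=> mL m1L; rewrite IH // mul0r addr0.
Qed.

Lemma raise_word L : uniq (unzip2 L) -> m \in unzip2 L -> m.+1 \notin unzip2 L ->
  F (word L) = word (map2nd (adj m) L).
Proof.
elim: L => [//|[i j] L IH] /= /andP[jL uL].
rewrite !inE !negb_or !word_cons FM Fx KVx /raise /wtV ![_ == j]eq_sym /adj /=.
case: (adjP m j) => [?|//|? ?] /=; first subst j.
  move=> _ m1L; rewrite raise_word0 // mulr0 add0r.
  congr (_ * word _); rewrite map2nd_id // => j jL'.
  rewrite /adj; case: (adjP m j) => // ?; subst j; first by rewrite jL' in jL.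
  by rewrite jL' in m1L.
by move=> mL m1L; rewrite IH // mul0r addr0 scale1r.
Qed.

(** In the Leibniz rule K acts on the letters to the right of the lowered one. It meets the letter
    m, and contributes q, exactly when m comes after m+1. *)
Lemma lower_word_both L : uniq (unzip2 L) -> m \in unzip2 L -> m.+1 \in unzip2 L ->
  E (word L) = (if appears_before m m.+1 (unzip2 L) then 1 else t) *:
     word (map2nd collapse L).
Proof.
have clps L' : m.+1 \notin unzip2 L' -> map2nd collapse L' = L'.
  move=> m1L; apply: map2nd_id => j jL; rewrite /collapse.
  by case: eqP => // ?; subst j; rewrite jL in m1L.
rewrite /appears_before.
elim: L => [//|[i j] L IH] /= /andP[jL uL].
rewrite !inE !word_cons EM Ex /lower ![_ == j]eq_sym {2}/collapse /=.
case: (adjP m j) => [?|?|? ?] /=; first subst j.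
- move=> _ m1L; rewrite mul0r addr0 lower_word // scale1r.
  congr (_ * word _); apply/eq_in_map => -[i' j'] ijL /=; congr (_, _).
  rewrite /adj /collapse; case: (adjP m j') => // ?; subst j'.
  by case/negP: jL; apply/mapP; exists (i', m).
- subst j => mL _; rewrite lower_word0 // mulr0 add0r.
  by rewrite weight_word_low // clps // scalerAr.
- by move=> mL m1L; rewrite IH // mul0r addr0 ltnS scalerAr.
Qed.

End Words.

(** * Quantum minors *)

Lemma big_linear (R : comNzRingType) (A B : algType R) (f : A -> B) (I : eqType)
    (r : seq I) (c : I -> R) (w v : I -> A) :
    (forall u v, f (u + v) = f u + f v) -> (forall c u, f (c *: u) = c *: f u) ->
  f (\sum_(i <- r) c i *: w i) = \sum_(i <- r) c i *: f (w i).
Proof.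
move=> fD fZ; rewrite (big_morph f fD (additive_zero fD)).
by apply: eq_bigr => i _; rewrite fZ.
Qed.

(** Sign-reversing pairing. The predicate [b] splits the sum into two halves that [h] carries onto
    each other with opposite sign, so the cancellation holds in every characteristic. *)
Lemma big_pairing0 (V : zmodType) (I : eqType) (r : seq I) (h : I -> I)
    (b : pred I) (g : I -> V) :
    perm_eq (map h r) r -> {in r, forall i, b (h i) = ~~ b i} ->
    {in r, forall i, b i -> g (h i) = - g i} ->
  \sum_(i <- r) g i = 0.
Proof.
move=> hr bh gh; rewrite (bigID b) /= -[X in _ + X](perm_big _ hr) /= big_map.
rewrite big_seq_cond [X in _ + X]big_seq_cond.
rewrite [X in _ + X](eq_big (fun i => (i \in r) && b i) (fun i => - g i)).
- by rewrite sumrN subrr.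
- by move=> i; case: (boolP (i \in r)) => //= ir; rewrite bh // negbK.
- by move=> i /andP[ir]; rewrite bh // negbK; apply: gh.
Qed.

Lemma map_permutations_tact m (B : seq nat) :
  perm_eq (map (tact m) (permutations B)) (permutations (tact m B)).
Proof.
have tinj := inv_inj (@tactK m).
apply: uniq_perm; rewrite ?(map_inj_uniq tinj) ?permutations_uniq // => l.
rewrite -{1}(tactK m l) mem_map // !mem_permutations.
have ainj := inv_inj (@adjK m).
by rewrite -{2}(tactK m l); apply/idP/idP => [/(perm_map (adj m))|/(perm_map_inj ainj)].
Qed.

Lemma perm_tact_both m (S : seq nat) : uniq S -> m \in S -> m.+1 \in S ->
  perm_eq (tact m S) S.
Proof.
move=> uS mS m1S; apply: uniq_perm; rewrite ?tact_uniq // => j.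
by rewrite mem_tact /adj; case: (adjP m j) => // ->; rewrite ?mS ?m1S.
Qed.

Lemma index_tact m j S : index j (tact m S) = index (adj m j) S.
Proof. by rewrite -{1}(adjK m j) index_map //; apply/inv_inj/adjK. Qed.

Lemma appears_before_tact m S : m \in S ->
  appears_before m m.+1 (tact m S) = ~~ appears_before m m.+1 S.
Proof.
move=> mS; rewrite /appears_before !index_tact adj_low adj_high -leqNgt.
rewrite [RHS]leq_eqVlt; case: eqP => // e.
have m1S : m.+1 \in S by rewrite -index_mem e index_mem.
by have := congr1 (nth m S) e; rewrite !nth_index //; lia.
Qed.

Section SignedWords.
Variables (R : comNzRingType) (A : algType R) (tV : R) (x : nat -> nat -> A).

(* The quantum minor [Z, S] of increasing tuples as a sum over the orderings
   of [S] instead of over permutations of the index set. *)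
Definition minor_sum (Z S : seq nat) : A :=
  \sum_(l <- permutations S) (- tV) ^+ tinv l *: word x (zip Z l).

Lemma minor_sum_perm Z S S' : perm_eq S S' -> minor_sum Z S = minor_sum Z S'.
Proof. by move=> SS'; apply: perm_big; apply: perm_permutations. Qed.

(** The minor for tuples in any order, over a family in an arbitrary algebra. Only [Z] is sorted,
    since the sum already runs over all orderings of [S]. *)
Definition gminor (Z S : seq nat) : A :=
  (- tV) ^+ (tinv Z + tinv S) *: minor_sum (sort leq Z) S.

Lemma zip_map2nd f (s l : seq nat) : map2nd f (zip s l) = zip s (map f l).
Proof. by elim: s l => [|i s IH] [|j l] //=; congr (_ :: _); apply: IH. Qed.

Lemma word_orient (s l : seq nat) :
  word (orient true x) (zip l s) = word x (zip s l).
Proof.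
rewrite /word; elim: s l => [|i s IH] [|j l] //=; rewrite ?big_nil //.
by rewrite !big_cons IH.
Qed.

End SignedWords.

Section Focus.
Variables (R : comNzRingType) (A : algType R) (t tV : R) (m : nat).
Variables (E F K KV : A -> A).
Hypothesis t_inv : t * tV = 1.

(** What FE needs to know about a minor as a function of the tuple on which the operators act.
    Minors have these properties in their column tuple and in their row tuple, so products of two
    minors are treated once for both. *)
Record focus_family (P : pred (seq nat)) (X : seq nat -> A) : Prop := FocusFamily {
  focE0 : forall S, P S -> m.+1 \notin S -> E (X S) = 0;
  focE_both : forall S, P S -> m \in S -> m.+1 \in S -> E (X S) = 0;
  focE : forall S, P S -> m \notin S -> m.+1 \in S -> E (X S) = X (tact m S);
  focF0 : forall S, P S -> m \notin S -> F (X S) = 0;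
  focF : forall S, P S -> m \in S -> m.+1 \notin S -> F (X S) = X (tact m S);
  focK : forall S, P S -> m \in S -> m.+1 \notin S -> K (X S) = t *: X S;
  focKV : forall S, P S -> m \in S -> m.+1 \notin S -> KV (X S) = tV *: X S;
  foc_swap : forall S, P S -> m \in S -> m.+1 \in S ->
    appears_before m m.+1 S -> X (tact m S) = - tV *: X S }.

Section Columns.
Variables (x : nat -> nat -> A) (Z : seq nat).
Hypothesis chev : chevalley t tV m x E F K KV.

Let PZ : pred (seq nat) := fun S => uniq S && (size S == size Z).

Lemma minor_sum_lin f (S : seq nat) : PZ S ->
    (forall u v, f (u + v) = f u + f v) -> (forall c u, f (c *: u) = c *: f u) ->
    forall g : seq nat -> A,
    (forall l, perm_eq l S -> unzip2 (zip (sort leq Z) l) = l -> uniq l ->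
       f (word x (zip (sort leq Z) l)) = g l) ->
  f (gminor tV x Z S) = (- tV) ^+ (tinv Z + tinv S) *:
    \sum_(l <- permutations S) (- tV) ^+ tinv l *: g l.
Proof.
move=> /andP[uS /eqP sS] fD fZ g fg; rewrite /gminor fZ /minor_sum big_linear //.
congr (_ *: _); apply: eq_big_seq => l; rewrite mem_permutations => lS.
by rewrite fg ?(perm_uniq lS) // unzip2_zip // size_sort (perm_size lS) sS.
Qed.

Lemma gminor_tact_col S : PZ S -> ~~ ((m \in S) && (m.+1 \in S)) ->
  (- tV) ^+ (tinv Z + tinv S) *:
    \sum_(l <- permutations S) (- tV) ^+ tinv l *:
       word x (map2nd (adj m) (zip (sort leq Z) l)) = gminor tV x Z (tact m S).
Proof.
move=> /andP[uS _] nb; rewrite /gminor tinv_tact //; congr (_ *: _).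
rewrite /minor_sum -(perm_big _ (map_permutations_tact m S)) /= big_map.
apply: eq_big_seq => l; rewrite mem_permutations => lS.
by rewrite tinv_tact ?(perm_uniq lS) ?(perm_mem lS) // zip_map2nd.
Qed.

Lemma gminor_columns : focus_family PZ (gminor tV x Z).
Proof.
have [DE ZE] := (skewD (chevE chev), skewZ (chevE chev)).
have [DF ZF] := (skewD (chevF chev), skewZ (chevF chev)).
have [DK ZK] := (skewrD (chevE chev), skewrZ (chevE chev)).
have [DKV ZKV] := (skewlD (chevF chev), skewlZ (chevF chev)).
split=> S PS.
- move=> m1S; rewrite (minor_sum_lin PS DE ZE (g := fun=> 0)) => [|l lS zl ul].
    by rewrite big1 ?scaler0 // => l _; rewrite scaler0.
  by apply: (lower_word0 chev); rewrite zl (perm_mem lS).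
- move=> mS m1S; rewrite (minor_sum_lin PS DE ZE (g := fun l =>
    (if appears_before m m.+1 l then 1 else t) *:
      word x (map2nd (collapse m) (zip (sort leq Z) l)))) => [|l lS zl ul]; last first.
    by rewrite (lower_word_both chev) ?zl ?(perm_mem lS).
  (* Exchanging m and m+1 in an ordering leaves the collapsed word unchanged. The additional
     inversion gives -q^{-1} and K gives q, so the two terms cancel. *)
  rewrite (big_pairing0 (h := tact m) (b := appears_before m m.+1)) ?scaler0 //.
  + have /andP[uS _] := PS; apply: perm_trans (map_permutations_tact _ _) _.
    exact/perm_permutations/perm_tact_both.
  + move=> l; rewrite mem_permutations => lS.
    by rewrite appears_before_tact ?(perm_mem lS).
  + move=> l; rewrite mem_permutations => lS bl.
    have /andP[uS _] := PS.
    rewrite tinv_tact_both ?(perm_uniq lS) ?(perm_mem lS) //.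
    rewrite appears_before_tact ?(perm_mem lS) // bl scale1r !zip_map2nd.
    have -> : map (collapse m) (tact m l) = map (collapse m) l.
      rewrite -map_comp; apply: eq_map => j /=; rewrite /collapse /adj.
      by case: (adjP m j) => [?|?|? nj]; subst=> /=; rewrite ?eqxx ?(negPf nj) ?ltn_eqF.
    by rewrite scalerA exprSr -mulrA mulNr [tV * t]mulrC t_inv mulrN1 scaleNr.
- move=> mS m1S; rewrite (minor_sum_lin PS DE ZE (g := fun l =>
    word x (map2nd (adj m) (zip (sort leq Z) l)))) => [|l lS zl ul].
    by rewrite gminor_tact_col // (negPf mS).
  by rewrite (lower_word chev) ?zl ?(perm_mem lS).
- move=> mS; rewrite (minor_sum_lin PS DF ZF (g := fun=> 0)) => [|l lS zl ul].
    by rewrite big1 ?scaler0 // => l _; rewrite scaler0.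
  by apply: (raise_word0 chev); rewrite zl (perm_mem lS).
- move=> mS m1S; rewrite (minor_sum_lin PS DF ZF (g := fun l =>
    word x (map2nd (adj m) (zip (sort leq Z) l)))) => [|l lS zl ul].
    by rewrite gminor_tact_col // (negPf m1S) andbF.
  by rewrite (raise_word chev) ?zl ?(perm_mem lS).
- move=> mS m1S; rewrite (minor_sum_lin PS DK ZK (g := fun l =>
    t *: word x (zip (sort leq Z) l))) => [|l lS zl ul].
    rewrite /gminor [RHS]scalerA [_ * _ ^+ _]mulrC -[RHS]scalerA; congr (_ *: _).
    by rewrite scaler_sumr; apply: eq_bigr => l _; rewrite !scalerA mulrC.
  by rewrite (weight_word_low chev) ?zl ?(perm_mem lS).
- move=> mS m1S; rewrite (minor_sum_lin PS DKV ZKV (g := fun l =>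
    tV *: word x (zip (sort leq Z) l))) => [|l lS zl ul].
    rewrite /gminor [RHS]scalerA [_ * _ ^+ _]mulrC -[RHS]scalerA; congr (_ *: _).
    by rewrite scaler_sumr; apply: eq_bigr => l _; rewrite !scalerA mulrC.
  by rewrite (weightV_word_low chev) ?zl ?(perm_mem lS).
- move=> mS m1S bS; have /andP[uS _] := PS.
  rewrite /gminor tinv_tact_both // addnS exprS -scalerA.
  by rewrite (minor_sum_perm tV x _ (perm_tact_both uS mS m1S)).
Qed.

End Columns.
End Focus.

(** * The row operators on minors *)

Section SwapAt.
Variable k : nat.

Definition swap_at (l : seq nat) : seq nat :=
  take k l ++ [:: nth 0 l k.+1, nth 0 l k & drop k.+2 l]%N.

Lemma swap_atP (l : seq nat) : (k.+1 < size l)%N ->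
  exists u a b w, [/\ size u = k, l = u ++ [:: a, b & w] &
                      swap_at l = u ++ [:: b, a & w]].
Proof.
move=> kl; exists (take k l), (nth 0%N l k), (nth 0%N l k.+1), (drop k.+2 l).
have kl' := ltnW kl; split=> //; first by rewrite size_takel // ltnW.
by rewrite -drop_nth // -drop_nth // cat_take_drop.
Qed.

Lemma swap_at_cat u a b w : size u = k ->
  swap_at (u ++ [:: a, b & w]) = u ++ [:: b, a & w].
Proof.
move=> uk; rewrite /swap_at take_size_cat // !nth_cat uk ltnn ltnNge leqnSn /=.
rewrite subnn subSn // subnn /= drop_cat uk ltnNge -addn2 leq_addr /=.
by rewrite addKn /= drop0.
Qed.

Lemma swap_atK l : (k.+1 < size l)%N -> swap_at (swap_at l) = l.
Proof.
by move=> /swap_atP[u [a [b [w [uk -> ->]]]]]; rewrite swap_at_cat.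
Qed.

Lemma perm_swap_at l : (k.+1 < size l)%N -> perm_eq (swap_at l) l.
Proof.
move=> /swap_atP[u [a [b [w [_ -> ->]]]]].
by rewrite perm_cat2l -![[:: _, _ & w]]/([:: _; _] ++ w) perm_cat2r (perm_catC [:: b]).
Qed.

Lemma map_permutations_swap_at (W : seq nat) : (k.+1 < size W)%N ->
  perm_eq (map swap_at (permutations W)) (permutations W).
Proof.
move=> kW; have uP := permutations_uniq W.
have sz l : l \in permutations W -> (k.+1 < size l)%N.
  by rewrite mem_permutations => /perm_size ->.
have uM : uniq (map swap_at (permutations W)).
  rewrite map_inj_in_uniq // => l l' /sz lW /sz l'W e.
  by rewrite -(swap_atK lW) e swap_atK.
apply: uniq_perm => //.
have [|//|] := uniq_min_size uM (s2 := permutations W); last by [].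
- move=> _ /mapP[l lW ->]; rewrite mem_permutations.
  by apply: perm_trans (perm_swap_at (sz _ lW)) _; rewrite -mem_permutations.
- by rewrite size_map.
Qed.

End SwapAt.

Lemma sorted_ltn_split m (s : seq nat) : sorted ltn s -> m \in s -> m.+1 \in s ->
  exists s1 s2, s = s1 ++ [:: m, m.+1 & s2].
Proof.
move=> ss ms; case/splitPr: ms ss => s1 s2.
rewrite (sorted_pairwise ltn_trans) pairwise_cat /= => /and3P[lt1 _ /andP[lt2 p2]].
rewrite mem_cat inE gtn_eqF //= => /orP[m1s|m1s2].
  by have := allrelP lt1 _ m m1s (mem_head _ _); rewrite /= ltnNge leqnSn.
exists s1; case: s2 lt1 lt2 p2 m1s2 => [//|j s2] lt1 /= /andP[mj _] /andP[js _].
rewrite inE => /orP[/eqP <-|m1s]; first by exists s2.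
by have := allP js _ m1s => /=; lia.
Qed.

(** [adj m] is increasing on the entries of a tuple that does not contain both m and m+1. *)
Lemma sort_tact m (S : seq nat) : uniq S -> ~~ ((m \in S) && (m.+1 \in S)) ->
  sort leq (tact m S) = tact m (sort leq S).
Proof.
move=> uS nb; apply: (sorted_eq leq_trans anti_leq).
- exact: sort_sorted leq_total _.
- apply: (sub_sorted ltnW); apply: (homo_sorted_in (P := mem S) (e := ltn) (e' := ltn)).
  + move=> i j iS jS; move: nb; rewrite /adj.
    move: (iS : i \in S) (jS : j \in S) => {iS jS}.
    by case: (adjP m i) => [?|?|? ?]; case: (adjP m j) => [?|?|? ?]; subst;
      rewrite //= ?ltnn //; try lia; move=> -> ->.
  + by apply/allP => i; rewrite mem_sort.
  + by rewrite ltn_sorted_uniq_leq sort_uniq uS sort_sorted //; apply: leq_total.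
- rewrite perm_sort; apply: perm_map; rewrite perm_sym; exact: permEl (perm_sort _ _).
Qed.

Section Rows.
Variables (R : comNzRingType) (A : algType R) (t tV : R) (m : nat).
Variables (E F K KV : A -> A) (x : nat -> nat -> A) (W : seq nat).
Hypothesis t_inv : t * tV = 1.
Hypothesis chev : chevalley t tV m (orient true x) E F K KV.
Hypothesis x_row : forall i j l, (j < l)%N -> x i j * x i l = tV *: (x i l * x i j).
Hypothesis W_uniq : uniq W.

Let PW : pred (seq nat) := fun S => uniq S && (size S == size W).
Let y := orient true x.

Lemma gminor_row_lin f (S : seq nat) : PW S ->
    (forall u v, f (u + v) = f u + f v) -> (forall c u, f (c *: u) = c *: f u) ->
    forall g : seq nat -> A,
    (forall l, perm_eq l W -> unzip2 (zip l (sort leq S)) = sort leq S ->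
       f (word y (zip l (sort leq S))) = g l) ->
  f (gminor tV x S W) = (- tV) ^+ (tinv S + tinv W) *:
    \sum_(l <- permutations W) (- tV) ^+ tinv l *: g l.
Proof.
move=> /andP[uS /eqP sS] fD fZ g fg; rewrite /gminor fZ /minor_sum big_linear //.
congr (_ *: _); apply: eq_big_seq => l; rewrite mem_permutations => lW.
by rewrite -word_orient fg // unzip2_zip // size_sort (perm_size lW) sS.
Qed.

Lemma gminor_tact_row S : PW S -> ~~ ((m \in S) && (m.+1 \in S)) ->
  (- tV) ^+ (tinv S + tinv W) *:
    \sum_(l <- permutations W) (- tV) ^+ tinv l *:
       word y (map2nd (adj m) (zip l (sort leq S))) = gminor tV x (tact m S) W.
Proof.
move=> /andP[uS _] nb; rewrite /gminor tinv_tact // sort_tact //; congr (_ *: _).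
by apply: eq_bigr => l _; rewrite zip_map2nd word_orient.
Qed.

Lemma word_cat (z : nat -> nat -> A) L1 L2 : word z (L1 ++ L2) = word z L1 * word z L2.
Proof. by rewrite /word big_cat. Qed.

(** In the sorted row tuple m and m+1 are neighbours, so after collapsing two generators of row m
    stand side by side. Exchanging their columns costs q^{-1} by the row relation, while the change
    of inversions gives -q^{-1}; the terms cancel in pairs. *)
Lemma sum_word_collapse0 S : PW S -> m \in S -> m.+1 \in S ->
  \sum_(l <- permutations W) (- tV) ^+ tinv l *:
       word y (map2nd (collapse m) (zip l (sort leq S))) = 0.
Proof.
move=> /andP[uS /eqP sS] mS m1S.
have /(sorted_ltn_split (m := m)) : sorted ltn (sort leq S).
  by rewrite ltn_sorted_uniq_leq sort_uniq uS sort_sorted //; apply: leq_total.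
rewrite !mem_sort => /(_ mS m1S)[s1 [s2 es]].
have kW : ((size s1).+1 < size W)%N.
  by rewrite -sS -(size_sort leq) es size_cat /=; lia.
have sz l : perm_eq l W -> ((size s1).+1 < size l)%N by move/perm_size->.
(* The two orderings of a pair are told apart by whether their columns increase at the positions of
   m and m+1. *)
pose b (l : seq nat) := (nth 0 l (size s1) < nth 0 l (size s1).+1)%N.
have bE u i j w : size u = size s1 -> b (u ++ [:: i, j & w]) = (i < j)%N.
  move=> us; have ks : ((size s1).+1 < size s1)%N = false by lia.
  by rewrite /b !nth_cat us ltnn ks subnn subSn // subnn.
apply: (big_pairing0 (h := swap_at (size s1)) (b := b)).
- exact: map_permutations_swap_at.
- move=> l; rewrite mem_permutations => lW.
  have [u [i [j [w [us el ->]]]]] := swap_atP (sz _ lW).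
  rewrite el !bE // -leqNgt [RHS]leq_eqVlt; case: eqP => // ij.
  have : uniq l by rewrite (perm_uniq lW).
  by rewrite el ij cat_uniq /= inE eqxx /= !andbF.
- move=> l; rewrite mem_permutations => lW.
  have [u [i [j [w [us -> ->]]]]] := swap_atP (sz _ lW); rewrite bE // => ij.
  rewrite tinv_swap // es !zip_map2nd map_cat /= !zip_cat ?size_map // !word_cat /=.
  have -> : collapse m m = m by rewrite /collapse; case: eqP.
  have -> : collapse m m.+1 = m by rewrite /collapse eqxx.
  have yE i' : y i' m = x m i' by [].
  rewrite !word_cons /= !yE !(mulrA (x m _)) (x_row m ij) -!scalerAl -!scalerAr scalerA.
  by rewrite exprSr mulrN scaleNr.
Qed.

Lemma gminor_rows : focus_family t tV m E F K KV PW (fun S => gminor tV x S W).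
Proof.
have [DE ZE] := (skewD (chevE chev), skewZ (chevE chev)).
have [DF ZF] := (skewD (chevF chev), skewZ (chevF chev)).
have [DK ZK] := (skewrD (chevE chev), skewrZ (chevE chev)).
have [DKV ZKV] := (skewlD (chevF chev), skewlZ (chevF chev)).
split=> S PS; have /andP[uS _] := PS.
- move=> m1S; rewrite (gminor_row_lin PS DE ZE (g := fun=> 0)) => [|l lS zl].
    by rewrite big1 ?scaler0 // => l _; rewrite scaler0.
  by apply: (lower_word0 chev); rewrite zl mem_sort.
- move=> mS m1S; rewrite (gminor_row_lin PS DE ZE (g := fun l =>
    word y (map2nd (collapse m) (zip l (sort leq S))))) => [|l lS zl].
    by rewrite sum_word_collapse0 // scaler0.
  rewrite (lower_word_both chev) zl ?mem_sort ?sort_uniq //.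
  (* The row tuple is sorted, so m precedes m+1 in every word and the factor q never occurs. *)
  have ss : sorted ltn (sort leq S).
    by rewrite ltn_sorted_uniq_leq sort_uniq uS sort_sorted //; apply: leq_total.
  have [s1 [s2 es]] : exists s1 s2, sort leq S = s1 ++ [:: m, m.+1 & s2].
    by apply: sorted_ltn_split; rewrite ?mem_sort.
  have : uniq (sort leq S) by rewrite sort_uniq.
  rewrite {1 2}es cat_uniq /= => /and3P[_].
  rewrite !negb_or => /and3P[/negPf ms1 /negPf m1s1 _] _.
  rewrite /appears_before !index_cat ms1 m1s1 /= eqxx ltn_eqF // eqxx.
  by rewrite ltn_add2l scale1r.
- move=> mS m1S; rewrite (gminor_row_lin PS DE ZE (g := fun l =>
    word y (map2nd (adj m) (zip l (sort leq S))))) => [|l lS zl].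
    by rewrite gminor_tact_row // (negPf mS).
  by rewrite (lower_word chev) ?zl ?mem_sort ?sort_uniq.
- move=> mS; rewrite (gminor_row_lin PS DF ZF (g := fun=> 0)) => [|l lS zl].
    by rewrite big1 ?scaler0 // => l _; rewrite scaler0.
  by apply: (raise_word0 chev); rewrite zl mem_sort.
- move=> mS m1S; rewrite (gminor_row_lin PS DF ZF (g := fun l =>
    word y (map2nd (adj m) (zip l (sort leq S))))) => [|l lS zl].
    by rewrite gminor_tact_row // (negPf m1S) andbF.
  by rewrite (raise_word chev) ?zl ?mem_sort ?sort_uniq.
- move=> mS m1S; rewrite (gminor_row_lin PS DK ZK (g := fun l =>
    t *: word y (zip l (sort leq S)))) => [|l lS zl].
    rewrite /gminor [RHS]scalerA [_ * _ ^+ _]mulrC -[RHS]scalerA; congr (_ *: _).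
    rewrite scaler_sumr; apply: eq_bigr => l _.
    by rewrite !scalerA mulrC word_orient.
  by rewrite (weight_word_low chev) ?zl ?mem_sort ?sort_uniq.
- move=> mS m1S; rewrite (gminor_row_lin PS DKV ZKV (g := fun l =>
    tV *: word y (zip l (sort leq S)))) => [|l lS zl].
    rewrite /gminor [RHS]scalerA [_ * _ ^+ _]mulrC -[RHS]scalerA; congr (_ *: _).
    rewrite scaler_sumr; apply: eq_bigr => l _.
    by rewrite !scalerA mulrC word_orient.
  by rewrite (weightV_word_low chev) ?zl ?mem_sort ?sort_uniq.
- move=> mS m1S bS.
  rewrite /gminor tinv_tact_both // addSn exprS -scalerA.
  have -> // : sort leq (tact m S) = sort leq S.
  by apply/(perm_sortP leq_total leq_trans anti_leq)/perm_tact_both.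
Qed.

End Rows.

(** * FE on a product of two complementary minors *)

Section Casimir.
Variables (R : comNzRingType) (A : algType R) (t tV : R) (m : nat).
Variables (E F K KV : A -> A) (y : nat -> nat -> A).
Hypothesis t_inv : t * tV = 1.
Hypothesis chev : chevalley t tV m y E F K KV.

(** If one factor contains both m and m+1, then E kills the product and the right hand side vanishes
    by the swap rule. Otherwise E acts on the factor containing m+1; F then either undoes this,
    giving the diagonal term, or acts on the other factor, giving the exchanged product. When m+1
    stands in the first factor, K contributes q to both terms, and K^{-1} cancels it in the
    exchanged one. *)
Lemma casimir_focus (P P' : pred (seq nat)) X X' S S' :
    focus_family t tV m E F K KV P X -> focus_family t tV m E F K KV P' X' ->
    P S -> P' S' -> uniq (S ++ S') -> m \in S ++ S' -> m.+1 \in S ++ S' ->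
    P (tact m S) -> P' (tact m S') ->
  F (E (X S * X' S')) = X (tact m S) * X' (tact m S') +
    (if appears_before m m.+1 (S ++ S') then tV else t) *: (X S * X' S').
Proof.
move=> fX fX' PS PS' uSS mSS m1SS PtS PtS'.
have [EM FM] := (skewM (chevE chev), skewM (chevF chev)).
have FD := skewD (chevF chev); have FZ := skewZ (chevF chev).
have F0 := additive_zero FD.
have nS' j : j \in S -> j \notin S'.
  move=> jS; move: uSS; rewrite cat_uniq => /and3P[_ /hasPn h _].
  by apply/negP => /h; rewrite /= jS.
have inS' j : j \in S ++ S' -> j \notin S -> j \in S'.
  by rewrite mem_cat => /orP[->|].
have mt : (m \in tact m S) = (m.+1 \in S) by rewrite mem_tact adj_low.
have m1t : (m.+1 \in tact m S) = (m \in S) by rewrite mem_tact adj_high.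
have mt' : (m \in tact m S') = (m.+1 \in S') by rewrite mem_tact adj_low.
have m1t' : (m.+1 \in tact m S') = (m \in S') by rewrite mem_tact adj_high.
have ms : m.+1 != m by rewrite gtn_eqF.
have tVt : tV * t = 1 by rewrite mulrC.
have [uS uS'] : uniq S /\ uniq S' by move: uSS; rewrite cat_uniq => /and3P[].
(* The swap rule read backwards, for a tuple in which m+1 comes before m. *)
have swapN Q Z (fZ : focus_family t tV m E F K KV Q Z) T : Q (tact m T) ->
    uniq T -> m \in T -> m.+1 \in T -> ~~ appears_before m m.+1 T ->
    Z (tact m T) = - t *: Z T.
  move=> QT uT mT m1T; rewrite -appears_before_tact // => bT.
  have := foc_swap fZ QT; rewrite !mem_tact adj_low adj_high tactK.
  move=> /(_ m1T mT bT) ->.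
  by rewrite scalerA mulrNN t_inv scale1r.
rewrite /appears_before !index_cat EM.
case mS : (m \in S); case m1S : (m.+1 \in S).
- have [mS' m1S'] := (nS' _ mS, nS' _ m1S).
  rewrite (focE_both fX PS) // (focE0 fX' PS') // mulr0 mul0r addr0 F0.
  rewrite (tact_id mS' m1S') -/(appears_before m m.+1 S).
  case: (boolP (appears_before m m.+1 S)) => bS.
    by rewrite (foc_swap fX PS) // -scalerAl scaleNr addNr.
  by rewrite (swapN _ _ fX) // -scalerAl scaleNr addNr.
- have m1S' := inS' _ m1SS (negbT m1S); have mS' := nS' _ mS.
  rewrite (focE0 fX PS) ?m1S // mul0r addr0 (focE fX' PS') // FM.
  rewrite (focF fX PS) ?m1S // (focKV fX PS) ?m1S //.
  rewrite (focF fX' PtS') ?mt' ?m1t' // tactK.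
  rewrite ltn_addr ?index_mem // -scalerAl addrC; congr (_ + _).
- have mS' := inS' _ mSS (negbT mS); have m1S' := nS' _ m1S.
  rewrite (focE0 fX' PS') // mulr0 add0r (focE fX PS) ?mS //.
  rewrite (focK fX' PS') // -scalerAr FZ FM.
  rewrite (focF fX PtS) ?mt ?m1t ?mS // tactK (focF fX' PS') //.
  rewrite (focKV fX PtS) ?mt ?m1t ?mS // -scalerAl scalerDr scalerA t_inv scale1r.
  by rewrite ltnNge ltnW ?ltn_addr ?index_mem //= addrC.
- have [mS' m1S'] := (inS' _ mSS (negbT mS), inS' _ m1SS (negbT m1S)).
  rewrite (focE0 fX PS) ?m1S // (focE_both fX' PS') // mulr0 mul0r addr0 F0.
  rewrite (tact_id (negbT mS) (negbT m1S)) ltn_add2l -/(appears_before m m.+1 S').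
  case: (boolP (appears_before m m.+1 S')) => bS'.
    by rewrite (foc_swap fX' PS') // -scalerAr scaleNr addNr.
  by rewrite (swapN _ _ fX') // -scalerAr scaleNr addNr.
Qed.

End Casimir.

(** * Permutation sums and sums over orderings define the same minors *)

Lemma tinv_map (f : nat -> nat) (l : seq nat) :
  {in l &, forall i j, (f i < f j)%N = (i < j)%N} -> tinv (map f l) = tinv l.
Proof.
elim: l => [//|j l IH] mf; rewrite /= !tinv_cons IH; last first.
  by move=> i i' il i'l; apply: mf; rewrite inE ?il ?i'l orbT.
congr (_ + _)%N; rewrite count_map; apply: eq_in_count => i il /=.
by apply: mf; rewrite inE ?il ?eqxx ?orbT.
Qed.

Lemma seq_enum_ord (S : seq nat) : [seq nth 0%N S (val a) | a <- enum 'I_(size S)] = S.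
Proof. by rewrite -[RHS](mkseq_nth 0%N) /mkseq -val_enum_ord -map_comp. Qed.

Section PermSeq.
Variables (p : nat) (S : seq nat).
Hypotheses (Sp : size S = p) (S_uniq : uniq S).

Definition perm_seq (s : 'S_p) : seq nat := [seq nth 0%N S (s a) | a <- enum 'I_p].

Lemma perm_seq_inj : injective perm_seq.
Proof.
move=> s s' /eq_in_map e; apply/permP => a; apply: val_inj.
have := e a (mem_enum _ a) => /eqP.
by rewrite nth_uniq ?Sp ?ltn_ord // => /eqP.
Qed.

Lemma perm_seq_perm s : perm_eq (perm_seq s) S.
Proof.
rewrite -[S in perm_eq _ S]seq_enum_ord.
have -> : [seq nth 0%N S (val a) | a <- enum 'I_(size S)] =
    [seq nth 0%N S (val a) | a <- enum 'I_p].
  by rewrite Sp.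
rewrite /perm_seq (map_comp (fun a : 'I_p => nth 0%N S (val a)) s); apply: perm_map.
apply: uniq_perm; rewrite ?(map_inj_uniq (@perm_inj _ s)) ?enum_uniq // => a.
by rewrite mem_enum; apply/mapP; exists (s^-1 a)%g; rewrite ?mem_enum ?permKV.
Qed.

(** An injective map into the orderings of [S] is onto because both sides have p! elements. *)
Lemma permutations_perm_seq : perm_eq (map perm_seq (enum 'S_p)) (permutations S).
Proof.
have uM : uniq (map perm_seq (enum 'S_p)).
  by rewrite (map_inj_uniq perm_seq_inj) enum_uniq.
apply: uniq_perm; rewrite ?permutations_uniq //.
have [|//|] := uniq_min_size uM (s2 := permutations S); last by [].
- by move=> _ /mapP[s _ ->]; rewrite mem_permutations perm_seq_perm.
- by rewrite size_map -cardE card_Sn size_permutations // Sp.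
Qed.

End PermSeq.

Lemma sum_perm_minor_sum (R : comNzRingType) (A : algType R) (tV : R)
    (x : nat -> nat -> A) (Z S : seq nat) :
    size Z = size S -> sorted ltn S ->
  \sum_(s : 'S_(size Z))
    (- tV) ^+ tinv [seq val (s a) | a <- enum 'I_(size Z)] *:
      \prod_(a < size Z) x (nth 0%N Z a) (nth 0%N S (s a)) = minor_sum tV x Z S.
Proof.
move=> ZS sS; have uS : uniq S by apply: sorted_uniq ltn_trans ltnn _ _.
rewrite /minor_sum -(perm_big _ (permutations_perm_seq (esym ZS) uS)) /= big_map big_enum.
apply: eq_bigr => s _; congr (_ ^+ _ *: _).
  (* [S] is increasing, so reading it through a permutation preserves the number of inversions. *)
  rewrite /perm_seq (map_comp (nth 0%N S) (fun a => val (s a))) tinv_map //.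
  move=> _ _ /mapP[a _ ->] /mapP[b _ ->].
  have hS := sorted_ltn_nth ltn_trans 0%N sS.
  have inS (c : 'I_(size Z)) : val c \in [pred k | (k < size S)%N].
    by rewrite inE -ZS; exact: ltn_ord.
  case: (ltngtP (s a) (s b)) => [ab|ba|/val_inj ->]; last by rewrite ltnn.
  - exact: hS.
  - by apply/negbTE; rewrite -leqNgt; apply: ltnW; apply: hS.
have -> : zip Z (perm_seq S s) =
    [seq (nth 0%N Z (val a), nth 0%N S (val (s a))) | a <- enum 'I_(size Z)].
  rewrite -[Z in zip Z]seq_enum_ord /perm_seq.
  by elim: (enum _) => //= a l ->.
by rewrite /word big_map [index_enum _]unlock -enumT.
Qed.

Lemma minor_gminor (R : comNzRingType) (t tV : R) (n : nat) (Z S : seq nat) :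
  size Z = size S -> uniq S -> minor t tV n Z S = gminor tV (qx t tV n) Z S.
Proof.
move=> ZS uS.
have sS : sorted ltn (sort leq S).
  by rewrite ltn_sorted_uniq_leq sort_uniq uS sort_sorted //; apply: leq_total.
have ZS' : size (sort leq Z) = size (sort leq S) by rewrite !size_sort.
have e : minor_inc t tV n (sort leq Z) (sort leq S) =
    minor_sum tV (qx t tV n) (sort leq Z) S.
  apply: etrans (sum_perm_minor_sum tV (qx t tV n) ZS' sS) _.
  by apply: minor_sum_perm; exact: permEl (perm_sort _ _).
by rewrite /minor /gminor e.
Qed.

(** Invariant of all entries of the lists. It guarantees that m and m+1 each occur exactly once in
    (Z,Z') and in (W,W'), as the formula for FE requires. *)
Definition entry_ok (n : nat) (c : entry) : bool :=
  [&& perm_eq (eZ c ++ eZ' c) (iota 1 n), perm_eq (eW c ++ eW' c) (iota 1 n),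
      size (eZ c) == size (eW c) & size (eZ' c) == size (eW' c)].

Lemma entry_okP n c : reflect
  [/\ perm_eq (eZ c ++ eZ' c) (iota 1 n), perm_eq (eW c ++ eW' c) (iota 1 n),
      size (eZ c) = size (eW c) & size (eZ' c) = size (eW' c)] (entry_ok n c).
Proof. by apply: (iffP and4P) => -[? ? /eqP ? /eqP ?]; split=> //; apply/eqP. Qed.

(** * One step of a tower as a linear operator *)

Section Steps.
Variables (R : comNzRingType) (t tV : R) (n m : nat).
Hypotheses (t_inv : t * tV = 1) (m_gt0 : (0 < m)%N) (m_ltn : (m < n)%N).
Local Notation Oq := (qmat t tV n).

Definition entry_val (c : entry) : Oq :=
  minor t tV n (eZ c) (eW c) * minor t tV n (eZ' c) (eW' c).

Lemma iota_mem_m (s : seq nat) : perm_eq s (iota 1 n) ->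
  [/\ uniq s, m \in s & m.+1 \in s].
Proof.
by move=> sn; rewrite (perm_uniq sn) !(perm_mem sn) iota_uniq !mem_iota; split; lia.
Qed.

Lemma tact_iota s : perm_eq s (iota 1 n) -> perm_eq (tact m s) (iota 1 n).
Proof.
move=> sn; have [us ms m1s] := iota_mem_m sn.
exact: perm_trans (perm_tact_both us ms m1s) sn.
Qed.

Lemma col_act_ok c : entry_ok n c -> entry_ok n (col_act m c).
Proof.
case/entry_okP=> Zn Wn ZW ZW'; apply/entry_okP.
by split; rewrite //= ?size_tact // /tact -map_cat tact_iota.
Qed.

Lemma row_act_ok c : entry_ok n c -> entry_ok n (row_act m c).
Proof.
case/entry_okP=> Zn Wn ZW ZW'; apply/entry_okP.
by split; rewrite //= ?size_tact // /tact -map_cat tact_iota.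
Qed.

Lemma entry_uniq c : entry_ok n c ->
  [/\ uniq (eZ c), uniq (eZ' c), uniq (eW c) & uniq (eW' c)].
Proof.
case/entry_okP=> /perm_uniq + /perm_uniq + _ _; rewrite !iota_uniq !cat_uniq.
by move=> /and3P[? _ ?] /and3P[? _ ?].
Qed.

Section AbstractSteps.
Variables (A : algType R) (x : nat -> nat -> A) (E F K KV : A -> A).

Definition gentry_val (c : entry) : A :=
  gminor tV x (eZ c) (eW c) * gminor tV x (eZ' c) (eW' c).

Lemma casimir_sub_linear (rows : bool) (s : R) :
    chevalley t tV m (orient rows x) E F K KV ->
  (forall u v, F (E (u + v)) - s *: (u + v) =
     F (E u) - s *: u + (F (E v) - s *: v)) /\
  (forall c u, F (E (c *: u)) - s *: (c *: u) = c *: (F (E u) - s *: u)).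
Proof.
move=> [dE dF _ _ _ _]; split=> [u v|c u].
  by rewrite (skewD dE) (skewD dF) scalerDr opprD addrACA.
by rewrite (skewZ dE) (skewZ dF) scalerBr !scalerA mulrC.
Qed.

Lemma casimir_col c : chevalley t tV m x E F K KV -> entry_ok n c ->
  F (E (gentry_val c)) - tV *: gentry_val c = gentry_val (col_act m c) +
    (if in_phi m c then 0 else (t - tV) *: gentry_val c).
Proof.
move=> chev ok; have [Zn Wn ZW ZW'] := entry_okP _ _ ok.
have [uZ uZ' uW uW'] := entry_uniq ok.
have [uWW mW m1W] := iota_mem_m Wn.
rewrite /gentry_val (casimir_focus t_inv chev (gminor_columns t_inv _ chev)
  (gminor_columns t_inv _ chev)) ?tact_uniq ?size_tact ?ZW ?ZW' ?eqxx ?uW ?uW' //.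
rewrite /in_phi; case: ifP => _; first by rewrite addrK addr0.
by rewrite -addrA -scalerBl.
Qed.

(** psi singles out m+1 before m, the order opposite to that of phi. Hence q is subtracted instead
    of q^{-1}, and the remaining coefficient has the opposite sign to that of a column step. *)
Lemma casimir_row c : chevalley t tV m (orient true x) E F K KV ->
    (forall i j l, (j < l)%N -> x i j * x i l = tV *: (x i l * x i j)) ->
    entry_ok n c ->
  F (E (gentry_val c)) - t *: gentry_val c = gentry_val (row_act m c) +
    (if in_psi m c then 0 else (tV - t) *: gentry_val c).
Proof.
move=> chev xr ok; have [Zn Wn ZW ZW'] := entry_okP _ _ ok.
have [uZ uZ' uW uW'] := entry_uniq ok.
have [uZZ mZ m1Z] := iota_mem_m Zn.
rewrite /gentry_val (casimir_focus t_inv chev (gminor_rows chev xr uW)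
  (gminor_rows chev xr uW')) ?tact_uniq ?size_tact ?ZW ?ZW' ?eqxx ?uZ ?uZ' //.
have -> : in_psi m c = ~~ appears_before m m.+1 (eZ c ++ eZ' c).
  rewrite -appears_before_tact // /in_psi /appears_before !index_tact.
  by rewrite adj_low adj_high.
case: (appears_before m m.+1 _) => /=; last by rewrite addrK addr0.
by rewrite -addrA -scalerBl.
Qed.

End AbstractSteps.

Lemma entry_val_gminor c : entry_ok n c ->
  entry_val c = gentry_val (qx t tV n) c.
Proof.
move=> ok; have [_ _ ZW ZW'] := entry_okP _ _ ok; have [_ _ uW uW'] := entry_uniq ok.
exact: (f_equal2 (@GRing.mul Oq) (minor_gminor t tV n ZW uW) (minor_gminor t tV n ZW' uW')).
Qed.

Lemma col_step : exists T : Oq -> Oq,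
  [/\ forall u v, T (u + v) = T u + T v, forall c u, T (c *: u) = c *: T u &
      forall c, entry_ok n c -> T (entry_val c) = entry_val (col_act m c) +
        (if in_phi m c then 0 else (t - tV) *: entry_val c)].
Proof.
have [E [F [K [KV chev]]]] := qmat_chevalley false t_inv m_gt0 m_ltn.
have [TD TZ] := casimir_sub_linear tV chev.
exists (fun u => F (E u) - tV *: u); split=> // c ok.
rewrite !entry_val_gminor //; last exact: col_act_ok.
exact: (casimir_col (x := qx t tV n) chev ok).
Qed.

Lemma row_step : exists T : Oq -> Oq,
  [/\ forall u v, T (u + v) = T u + T v, forall c u, T (c *: u) = c *: T u &
      forall c, entry_ok n c -> T (entry_val c) = entry_val (row_act m c) +
        (if in_psi m c then 0 else (tV - t) *: entry_val c)].
Proof.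
have [E [F [K [KV chev]]]] := qmat_chevalley true t_inv m_gt0 m_ltn.
have [TD TZ] := casimir_sub_linear t chev.
exists (fun u => F (E u) - t *: u); split=> // c ok.
rewrite !entry_val_gminor //; last exact: row_act_ok.
apply: casimir_row chev _ ok => i j l jl; rewrite -mulr_algl.
by have [xr _ _ _] := qx_family t tV n; apply: xr.
Qed.

End Steps.

Lemma mem_zip (s l : seq nat) (p : nat * nat) : p \in zip s l ->
  p.1 \in s /\ p.2 \in l.
Proof.
elim: s l => [|i s IH] [|j l] //=; rewrite !inE => /orP[/eqP ->|/IH[-> ->]].
  by rewrite !eqxx.
by rewrite !orbT.
Qed.

(** * Commuting minors, for the top of the towers *)

Section Commutation.
Variables (R : comNzRingType) (A : algType R) (t tV : R) (x : nat -> nat -> A).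
Hypothesis x_anti : forall i j l k, (i < l)%N -> (k < j)%N ->
  x i j * x l k = x l k * x i j.

Lemma commrZ (a : R) (u v : A) : GRing.comm u v -> GRing.comm u (a *: v).
Proof. by rewrite /GRing.comm -scalerAl -scalerAr => ->. Qed.

(** Each generator of the first minor has a smaller row and a larger column than each generator of
    the second, so the third relation applies factor by factor. *)
Lemma comm_gminor (Z S Z' S' : seq nat) :
    {in Z & Z', forall i l, (i < l)%N} -> {in S & S', forall j k, (k < j)%N} ->
  GRing.comm (gminor tV x Z S) (gminor tV x Z' S').
Proof.
move=> ZZ' SS'; rewrite /gminor /minor_sum big_seq.
rewrite [X in GRing.comm _ (_ *: X)]big_seq.
apply: commrZ; apply: commr_sum => l'; rewrite mem_permutations => lS'.
apply: commrZ; apply: commr_sym.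
apply: commrZ; apply: commr_sum => l; rewrite mem_permutations => lS.
apply: commrZ; rewrite /word big_seq [X in GRing.comm _ X]big_seq.
apply: commr_prod => -[i j] /mem_zip; rewrite mem_sort (perm_mem lS) => -[/= iZ jS].
apply: commr_sym; apply: commr_prod => -[i' j'] /mem_zip.
rewrite mem_sort (perm_mem lS') => -[/= iZ' jS'].
by apply: x_anti; [apply: ZZ'|apply: SS'].
Qed.

End Commutation.

Lemma commute_minor (R : comNzRingType) (t tV : R) (n : nat) (Z S Z' S' : seq nat) :
    size Z = size S -> size Z' = size S' -> uniq S -> uniq S' ->
    {in Z & Z', forall i l, (i < l)%N} -> {in S & S', forall j k, (k < j)%N} ->
  minor t tV n Z S * minor t tV n Z' S' = minor t tV n Z' S' * minor t tV n Z S.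
Proof.
move=> ZS ZS' uS uS' lZ gS; have [_ _ xa _] := qx_family t tV n.
have e := minor_gminor t tV n ZS uS; have e' := minor_gminor t tV n ZS' uS'.
have c : GRing.comm (gminor tV (qx t tV n) Z S) (gminor tV (qx t tV n) Z' S').
  by apply: comm_gminor.
apply: (etrans (f_equal2 (@GRing.mul (qmat t tV n)) e e')); apply: (etrans c).
exact: (esym (f_equal2 (@GRing.mul (qmat t tV n)) e' e)).
Qed.

(** * Towers and lists *)

Section Increasing.
Local Open Scope nat_scope.
Implicit Types (n m : nat) (J : seq nat).

Lemma increasing_inP n J : increasing_in n J ->
  [/\ sorted ltn J, uniq J & forall j, j \in J -> 0 < j <= n].
Proof.
case/andP=> sJ /allP J_n; split=> //.
exact: sorted_uniq ltn_trans ltnn _ sJ.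
Qed.

Lemma increasing_iota n a r : 0 < a -> a + r <= n.+1 -> increasing_in n (iota a r).
Proof.
move=> a0 ar; rewrite /increasing_in iota_ltn_sorted.
by apply/allP => i; rewrite mem_iota; lia.
Qed.

Lemma sorted_leq_uniq_ltn (s : seq nat) : uniq s -> sorted leq s -> sorted ltn s.
Proof. by move=> us ss; rewrite ltn_sorted_uniq_leq us. Qed.

Lemma sorted_tact m (s : seq nat) : sorted ltn s ->
  ~~ ((m \in s) && (m.+1 \in s)) -> sorted ltn (tact m s).
Proof.
move=> ss nb; have us := sorted_uniq ltn_trans ltnn ss.
apply: sorted_leq_uniq_ltn; first by rewrite tact_uniq.
rewrite -[s in tact m s](sorted_sort leq_trans (sub_sorted ltnW ss)) -sort_tact //.
exact: sort_sorted leq_total _.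
Qed.

Lemma increasing_tact n m J : 0 < m < n -> increasing_in n J ->
  ~~ ((m \in J) && (m.+1 \in J)) -> increasing_in n (tact m J).
Proof.
move=> mn /increasing_inP[sJ uJ J_n] nb; rewrite /increasing_in sorted_tact //=.
apply/allP => j; rewrite mem_tact => /J_n.
by rewrite /adj; case: (adjP m j) => // ->; lia.
Qed.

Lemma sorted_ltn_eq (s1 s2 : seq nat) :
  sorted ltn s1 -> sorted ltn s2 -> s1 =i s2 -> s1 = s2.
Proof. exact: (irr_sorted_eq ltn_trans ltnn). Qed.

Lemma tcompl_sorted n J : sorted ltn (tcompl n J).
Proof. by apply: sorted_filter; [apply: ltn_trans|apply: iota_ltn_sorted]. Qed.

Lemma mem_tcompl n J j : (j \in tcompl n J) = (0 < j <= n) && (j \notin J).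
Proof. by rewrite mem_filter mem_iota add1n ltnS andbC. Qed.

(** Of m and m+1 one lies in [J] and the other in its complement, so the exchange keeps the
    complement increasing. No reordering is then needed when the transposition acts entrywise. *)
Lemma tact_tcompl n m J : 0 < m < n -> (m \in J) != (m.+1 \in J) ->
  tact m (tcompl n J) = tcompl n (tact m J).
Proof.
move=> mn mJ; apply: sorted_ltn_eq; rewrite ?tcompl_sorted //.
  apply: sorted_tact; rewrite ?tcompl_sorted // !mem_tcompl.
  by case: (m \in J) mJ; case: (m.+1 \in J); rewrite //= !andbF.
move=> j; rewrite mem_tact !mem_tcompl mem_tact; congr (_ && _).
by rewrite /adj; case: (adjP m j) => // ->; lia.
Qed.

Lemma perm_tcompl n J : increasing_in n J -> perm_eq (tcompl n J ++ J) (iota 1 n).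
Proof.
case/increasing_inP=> sJ uJ J_n; apply: uniq_perm; rewrite ?iota_uniq //.
  rewrite cat_uniq uJ andbT (sorted_uniq ltn_trans ltnn (tcompl_sorted n J)) /=.
  by apply/hasPn => j jJ; rewrite mem_tcompl jJ andbF.
move=> j; rewrite mem_cat mem_tcompl mem_iota add1n ltnS.
by case: (boolP (j \in J)) => [/J_n ->|_]; rewrite ?orbT ?andbT ?orbF.
Qed.

Lemma size_tcompl n J : increasing_in n J -> size (tcompl n J) = n - size J.
Proof.
by move=> /perm_tcompl/perm_size; rewrite size_cat size_iota => e; rewrite -[in RHS]e addnK.
Qed.

Lemma increasing_size n J : increasing_in n J -> size J <= n.
Proof.
move=> /perm_tcompl/perm_size; rewrite size_cat size_iota => e.
by rewrite -[X in _ <= X]e leq_addl.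
Qed.

(** The sum of the entries measures progress along a tower: each transposition changes it by one. *)
Lemma sumn_tact m J : uniq J -> m \in J -> m.+1 \notin J ->
  sumn (tact m J) = (sumn J).+1.
Proof.
move=> uJ mJ m1J; have pJ := perm_to_rem mJ.
rewrite (perm_sumn pJ) (perm_sumn (perm_map (adj m) pJ)) /= adj_low.
have -> : map (adj m) (rem m J) = rem m J; last by [].
apply: (tact_id (m := m)); rewrite mem_rem_uniq // inE ?eqxx //.
by rewrite (negPf m1J) andbF.
Qed.

Lemma leq_sumn_increasing n J : increasing_in n J -> sumn J <= n * size J.
Proof.
case/increasing_inP=> _ _; elim: J => [|j J IH] J_n; first by rewrite muln0.
rewrite /= mulnS leq_add //; first by have /andP[] := J_n j (mem_head _ _).
by apply: IH => i iJ; apply: J_n; rewrite inE iJ orbT.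
Qed.

(** The candidates for the pivot, in a form common to columns ([s'] is [s] shifted and closed by
    n+1) and rows ([s] is [s'] preceded by 0). *)
Definition gap_pairs (s s' : seq nat) := [seq u <- zip s s' | 1 < u.2 - u.1].

(** The closing n+1 forces the last entry to be n, and the others follow downwards. With r =
    [size J] + 1 the first entry n - r + 1 is [n - size J]. *)
Lemma gap_pairs_col0 n j J : path ltn j J -> all (fun i => i <= n) (j :: J) ->
  gap_pairs (j :: J) (rcons J n.+1) = [::] -> j :: J = iota (n - size J) (size J).+1.
Proof.
elim: J j => [|k J IH] j /=.
  move=> _ /andP[jn _]; rewrite /gap_pairs /=; case: ltnP => // jn' _.
  by rewrite subn0; congr [:: _]; lia.
case/andP=> jk pJ /andP[jn aJ]; rewrite /gap_pairs /=; case: ltnP => // kj gJ.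
have /= e := IH k pJ aJ gJ; have [ek eJ] : k = n - size J /\ J = iota (n - size J).+1 (size J).
  by case: e.
have ej : j = n - (size J).+1 by lia.
have ek' : k = j.+1 by lia.
by congr (_ :: _) => //; rewrite -ej -ek' e -ek.
Qed.

(** A gap pair has no entry strictly between its members; this places the successor of the pivot
    outside the tuple. *)
Lemma gap_pairs_col n j J u : path ltn j J -> all (fun i => i <= n) (j :: J) ->
  u \in zip (j :: J) (rcons J n.+1) ->
  [/\ u.1 \in j :: J, u.2 <= n.+1 & forall i, i \in j :: J -> (i <= u.1) || (u.2 <= i)].
Proof.
elim: J j => [|k J IH] j /=.
  move=> _ _; rewrite inE => /eqP -> /=; split=> //; rewrite ?inE ?eqxx //.
  by move=> i; rewrite inE => /eqP ->; rewrite leqnn.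
case/andP=> jk pJ /andP[jn aJ]; rewrite inE => /orP[/eqP -> /=|uz].
  split; rewrite ?inE ?eqxx //.
    by case/andP: aJ => kn _; apply: leqW.
  move=> i; rewrite !inE => /or3P[/eqP ->|/eqP ->|iJ]; rewrite ?leqnn ?orbT //.
  by have /allP/(_ i iJ) := order_path_min ltn_trans pJ; move=> /= /ltnW ->; rewrite orbT.
have [u1 u2 ui] := IH k pJ aJ uz; split=> //; first by rewrite inE u1 orbT.
move=> i; rewrite inE => /orP[/eqP ->|]; last exact: ui.
have : k <= u.1.
  move: u1; rewrite inE => /orP[/eqP ->|u1] //.
  by have /allP/(_ _ u1) := order_path_min ltn_trans pJ; move/ltnW.
by move=> ku; rewrite (leq_trans (ltnW jk) ku).
Qed.

Lemma gap_pairs_row0 a J : path ltn a J ->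
  gap_pairs (a :: J) J = [::] -> J = iota a.+1 (size J).
Proof.
elim: J a => [|k J IH] a //= /andP[ak pJ]; rewrite /gap_pairs /=.
case: ltnP => // ka gJ; have ek : k = a.+1 by lia.
by rewrite {1}(IH k pJ gJ) ek.
Qed.

Lemma gap_pairs_row a J u : path ltn a J -> u \in zip (a :: J) J ->
  [/\ u.1 \in a :: J, u.2 \in J & forall i, i \in J -> (i <= u.1) || (u.2 <= i)].
Proof.
elim: J a => [|k J IH] a //= /andP[ak pJ]; rewrite inE => /orP[/eqP -> /=|uz].
  split; rewrite ?inE ?eqxx //.
  move=> i; rewrite !inE => /orP[/eqP ->|iJ]; rewrite ?leqnn ?orbT //.
  by have /allP/(_ i iJ) := order_path_min ltn_trans pJ; move=> /= /ltnW ->; rewrite orbT.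
have [u1 u2 ui] := IH k pJ uz.
split=> //; [by rewrite inE u1 orbT|by rewrite inE u2 orbT|].
move=> i; rewrite inE => /orP[/eqP ->|]; last exact: ui.
move: u1; rewrite inE => /orP[/eqP ->|u1]; first by rewrite leqnn.
by have /allP/(_ _ u1) := order_path_min ltn_trans pJ; move=> /= /ltnW ->.
Qed.

Lemma last_in (T : eqType) (x0 : T) s : s != [::] -> last x0 s \in s.
Proof. by case: s => // x s _; rewrite /= mem_last. Qed.

Lemma head_in (T : eqType) (x0 : T) s : s != [::] -> head x0 s \in s.
Proof. by case: s => // x s _; rewrite mem_head. Qed.

Lemma col_pivotP n J : increasing_in n J -> J != col_top n (size J) ->
  [/\ 0 < col_pivot n J < n, col_pivot n J \in J & (col_pivot n J).+1 \notin J].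
Proof.
move=> incJ; have := increasing_size incJ; have [sJ uJ J_n] := increasing_inP incJ.
case: J sJ uJ J_n {incJ} => [//|j J] sJ uJ J_n rn nt.
have aJ : all (fun i => i <= n) (j :: J) by apply/allP => i /J_n/andP[].
have gJ : gap_pairs (j :: J) (rcons J n.+1) != [::].
  apply: contraNneq nt => /(gap_pairs_col0 sJ aJ) e; rewrite {1}e /col_top.
  have -> : (n - size (j :: J)).+1 = n - size J by rewrite -subSn // subSS.
  by rewrite eqxx.
rewrite /col_pivot -/(gap_pairs _ _) /=.
set m := last _ _.
have /mapP[u ug em] : m \in [seq u.1 | u <- gap_pairs (j :: J) (rcons J n.+1)].
  by apply: last_in; rewrite -size_eq0 size_map size_eq0.
move: ug; rewrite mem_filter => /andP[gu /(gap_pairs_col sJ aJ)[u1 u2 ui]].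
case: u em gu u1 u2 ui => a b /= -> gu u1 u2 ui; have u1_n := J_n _ u1; split=> //; first lia.
by apply/negP => /ui; lia.
Qed.

Lemma row_pivotP n I : increasing_in n I -> I != row_top (size I) ->
  [/\ 0 < row_pivot I < n, row_pivot I \notin I & (row_pivot I).+1 \in I].
Proof.
move=> incI nt; have [sI uI I_n] := increasing_inP incI.
have pI : path ltn 0 I.
  by rewrite path_sortedE ?sI ?andbT; [apply/allP => i /I_n/andP[]|apply: ltn_trans].
have gI : gap_pairs (0 :: I) I != [::].
  by apply: contraNneq nt => /(gap_pairs_row0 pI) e; rewrite {1}e.
rewrite /row_pivot -/(gap_pairs _ _).
set h := head _ _; have /mapP[u ug eh] : h \in [seq u.2 | u <- gap_pairs (0 :: I) I].
  by apply: head_in; rewrite -size_eq0 size_map size_eq0.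
move: ug; rewrite mem_filter => /andP[gu /(gap_pairs_row pI)[u1 u2 ui]].
case: u eh gu u1 u2 ui => a b /= -> gu u1 u2 ui; have u2_n := I_n _ u2.
(* [row_pivot] records i_p - 1, the smaller of the two exchanged values; here b is i_p, which is
   positive. *)
have u2E : b.-1.+1 = b by lia.
by rewrite u2E; split=> //; [lia|apply/negP => /ui; lia].
Qed.

End Increasing.

(** * Invariants of the lists *)

Section Lists.
Variables (n r : nat).

Definition list_ok (C : seq entry) : bool := all (entry_ok n) C.

Lemma col_list_nil cs i : (size cs < i)%N -> col_list n r cs i = [::].
Proof.
elim: cs i => [|m cs IH] [|i] //= si.
by rewrite !IH //; apply: ltnW.
Qed.

Lemma row_list_nil cs rs i : (size cs + size rs < i)%N -> row_list n r cs rs i = [::].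
Proof.
elim: rs i => [|m rs IH] [|i] //= si; first by apply: col_list_nil; rewrite addn0 in si.
by rewrite addnS ltnS in si; rewrite !IH //; apply: ltnW.
Qed.

Definition pivots_ok (s : seq nat) := all (fun m => 0 < m < n)%N s.

Lemma all_impl (T : Type) (p q : pred T) (s : seq T) :
  (forall c, p c -> q c) -> all p s -> all q s.
Proof. by move=> pq; elim: s => //= c s IH /andP[/pq -> /IH]. Qed.

Lemma all_filterW (T : Type) (p q : pred T) (s : seq T) :
  all p s -> all p (filter q s).
Proof. by elim: s => //= c s IH /andP[pc /IH ps]; case: (q c) => //=; rewrite pc. Qed.

Lemma base_entry_ok : (r <= n)%N ->
  entry_ok n (Entry 1 (row_top r) (tcompl n (row_top r))
                (col_top n r) (tcompl n (col_top n r))).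
Proof.
move=> rn.
have irow : increasing_in n (row_top r) by apply: increasing_iota.
have icol : increasing_in n (col_top n r) by apply: increasing_iota; lia.
apply/entry_okP; split; rewrite /= ?size_tcompl ?size_iota //.
- by rewrite perm_catC perm_tcompl.
- by rewrite perm_catC perm_tcompl.
Qed.

Lemma col_list_ok cs i : (r <= n)%N -> pivots_ok cs -> list_ok (col_list n r cs i).
Proof.
move=> rn; elim: cs i => [|m cs IH] i /=.
  by case: eqP => // _ _; rewrite /list_ok /= andbT; apply: base_entry_ok.
case/andP=> /andP[m0 mn] /IH{}IH; rewrite /list_ok all_map /=.
apply: (all_impl (p := entry_ok n)) => //; rewrite all_cat; apply/andP; split.
  by case: i => [|i] //; apply: all_filterW; apply: IH.
by rewrite all_map; apply: (all_impl _ (IH i)) => c; apply: col_act_ok.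
Qed.

Lemma col_list_sign cs i : all (fun c => esign c == (-1) ^+ i) (col_list n r cs i).
Proof.
case: cs => [|m cs] /=; first by case: eqP => [->|].
rewrite all_map; apply: (all_impl (p := predT)); last exact: all_predT.
by move=> c _ /=.
Qed.

Lemma row_list_ok cs rs i : (r <= n)%N -> pivots_ok cs -> pivots_ok rs ->
  list_ok (row_list n r cs rs i).
Proof.
move=> rn cs_ok; elim: rs i => [|m rs IH] i /=; first by move=> _; apply: col_list_ok.
case/andP=> /andP[m0 mn] /IH{}IH; rewrite /list_ok all_cat; apply/andP; split.
  by case: i => [|i] //; apply: all_filterW; apply: IH.
by rewrite all_map; apply: (all_impl _ (IH i)) => c; apply: row_act_ok.
Qed.

End Lists.

(** * The expansion along the two towers *)

Section Sums.
Variables (R : comNzRingType) (V : lmodType R) (v : entry -> V) (n r : nat) (h : R).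

Definition signed_sum (C : seq entry) : V := \sum_(c <- C) (esign c)%:~R *: v c.

Definition total_sum (cs rs : seq nat) : V :=
  \sum_(0 <= i < (size cs + size rs).+1)
    h ^+ i *: signed_sum (row_list n r cs rs i).

Lemma eq_big_all (p : pred entry) (C : seq entry) (f g : entry -> V) :
  all p C -> (forall c, p c -> f c = g c) -> \sum_(c <- C) f c = \sum_(c <- C) g c.
Proof.
move=> + fg; elim: C => [|c C IH] /=; first by rewrite !big_nil.
by case/andP=> pc /IH e; rewrite !big_cons fg // e.
Qed.

Lemma signed_sum_cat C C' : signed_sum (C ++ C') = signed_sum C + signed_sum C'.
Proof. exact: big_cat. Qed.

Section OneStep.
Variables (T : V -> V) (act : entry -> entry) (removed : pred entry) (d : R).
Hypothesis TD : forall u w, T (u + w) = T u + T w.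
Hypothesis TZ : forall c u, T (c *: u) = c *: T u.
Hypothesis T_entry : forall c, entry_ok n c ->
  T (v c) = v (act c) + (if removed c then 0 else d *: v c).

Lemma signed_sum_step C : list_ok n C ->
  T (signed_sum C) = \sum_(c <- C) (esign c)%:~R *: v (act c) +
    d *: signed_sum [seq c <- C | ~~ removed c].
Proof.
move=> C_ok; rewrite /signed_sum (big_morph T TD (additive_zero TD)).
rewrite big_filter [X in d *: X]big_mkcond scaler_sumr -big_split /=.
apply: eq_big_all C_ok _ => c c_ok; rewrite TZ T_entry // scalerDr.
by case: (removed c); rewrite /= ?scaler0 // !scalerA mulrC.
Qed.

(** With s' the old sums, a their images under the transposition and b the sums over elements
    outside phi or psi, the extra term d b_i = e h b_i carries one more power of h and so joins
    degree i+1. This is the recursion of the lists; e is the sign picked up on the way. The new sum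
    has one more degree, where a must vanish. *)
Lemma generating_sum_step (e : R) (M : nat) (s' a b s : nat -> V) :
    d = e * h -> (forall i, T (s' i) = a i + d *: b i) -> s 0%N = a 0%N ->
    (forall i, s i.+1 = e *: b i + a i.+1) -> a M.+1 = 0 ->
  T (\sum_(0 <= i < M.+1) h ^+ i *: s' i) = \sum_(0 <= i < M.+2) h ^+ i *: s i.
Proof.
move=> de Ts s0 sS aM; rewrite (big_morph T TD (additive_zero TD)).
rewrite [RHS]big_nat_recl // s0.
rewrite [X in _ + X](eq_bigr (fun i => h ^+ i.+1 *: a i.+1 + h ^+ i *: (d *: b i))).
  rewrite big_split /= addrA -(big_nat_recl _ _ (fun i => h ^+ i *: a i)) //.
  rewrite [X in _ = X + _]big_nat_recr //= aM scaler0 addr0 -big_split /=.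
  by apply: eq_bigr => i _; rewrite TZ Ts scalerDr.
move=> i _; rewrite sS scalerDr addrC; congr (_ + _).
by rewrite !scalerA de exprSr -mulrA [h * e]mulrC.
Qed.

End OneStep.

Hypothesis r_le_n : (r <= n)%N.
Hypothesis v_sign : forall e c, v (set_sign e c) = v c.

Lemma total_sum_col T m cs : (0 < m < n)%N -> pivots_ok n cs ->
    (forall u w, T (u + w) = T u + T w) -> (forall c u, T (c *: u) = c *: T u) ->
    (forall c, entry_ok n c -> T (v c) =
       v (col_act m c) + (if in_phi m c then 0 else (- h) *: v c)) ->
  T (total_sum cs [::]) = total_sum (m :: cs) [::].
Proof.
move=> mn cs_ok TD TZ Tv; rewrite /total_sum !addn0 /=.
have sgn i p (f : entry -> V) : \sum_(c <- filter p (col_list n r cs i)) (esign c)%:~R *: f c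
    = (-1) ^+ i *: \sum_(c <- filter p (col_list n r cs i)) f c.
  rewrite scaler_sumr; apply: (eq_big_all (all_filterW _ (col_list_sign n r cs i))).
  by move=> c /eqP ->; rewrite rmorphXn rmorphN1.
pose b i := signed_sum [seq c <- col_list n r cs i | ~~ in_phi m c].
pose a i := \sum_(c <- col_list n r cs i) (esign c)%:~R *: v (col_act m c).
(* An element kept from degree i to i+1 passes from the sign (-1)^i to (-1)^{i+1}, whence e = -1. *)
apply: (generating_sum_step TD TZ (d := - h) (e := -1) (a := a) (b := b)) => [||||].
- by rewrite mulN1r.
- by move=> i; apply: signed_sum_step => //; apply: col_list_ok.
- rewrite /signed_sum /a !big_map; apply: eq_big_all (col_list_sign n r cs 0) _.
  by move=> c /eqP /= ->; rewrite v_sign.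
- move=> i; rewrite /signed_sum /a /b map_cat big_cat /= !big_map; congr (_ + _).
    rewrite /signed_sum sgn scalerA -exprS scaler_sumr.
    by apply: eq_bigr => c _; rewrite /= v_sign rmorphXn rmorphN1.
  apply: eq_big_all (col_list_sign n r cs i.+1) _.
  by move=> c /eqP /= ->; rewrite v_sign.
- by rewrite /a col_list_nil // big_nil.
Qed.

Lemma total_sum_row T m cs rs : (0 < m < n)%N -> pivots_ok n cs -> pivots_ok n rs ->
    (forall u w, T (u + w) = T u + T w) -> (forall c u, T (c *: u) = c *: T u) ->
    (forall c, entry_ok n c -> T (v c) =
       v (row_act m c) + (if in_psi m c then 0 else h *: v c)) ->
  T (total_sum cs rs) = total_sum cs (m :: rs).
Proof.
move=> mn cs_ok rs_ok TD TZ Tv; rewrite /total_sum /= addnS.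
pose b i := signed_sum [seq c <- row_list n r cs rs i | ~~ in_psi m c].
pose a i := \sum_(c <- row_list n r cs rs i) (esign c)%:~R *: v (row_act m c).
(* Row steps leave signs unchanged, whence e = 1. *)
apply: (generating_sum_step TD TZ (d := h) (e := 1) (a := a) (b := b)) => [||||].
- by rewrite mul1r.
- by move=> i; apply: signed_sum_step => //; apply: row_list_ok.
- by rewrite /signed_sum /a big_map.
- by move=> i; rewrite scale1r signed_sum_cat /b {2}/signed_sum big_map.
- by rewrite /a row_list_nil // big_nil.
Qed.

(** The left hand side in the shape of a list element, with the complements in first place, so that
    the same operators apply to it. *)
Definition complement_entry (I J : seq nat) : entry :=
  Entry 1 (tcompl n I) I (tcompl n J) J.

Lemma complement_entry_ok I J : increasing_in n I -> increasing_in n J ->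
  size I = size J -> entry_ok n (complement_entry I J).
Proof.
move=> hI hJ IJ; apply/entry_okP; split; rewrite /= ?perm_tcompl //.
by rewrite !size_tcompl // IJ.
Qed.

Hypothesis col_stepH : forall m, (0 < m < n)%N -> exists T : V -> V,
  [/\ forall u w, T (u + w) = T u + T w, forall c u, T (c *: u) = c *: T u &
      forall c, entry_ok n c -> T (v c) = v (col_act m c) +
        (if in_phi m c then 0 else (- h) *: v c)].
Hypothesis row_stepH : forall m, (0 < m < n)%N -> exists T : V -> V,
  [/\ forall u w, T (u + w) = T u + T w, forall c u, T (c *: u) = c *: T u &
      forall c, entry_ok n c -> T (v c) = v (row_act m c) +
        (if in_psi m c then 0 else h *: v c)].
Hypothesis v_base : v (complement_entry (row_top r) (col_top n r)) =
  v (Entry 1 (row_top r) (tcompl n (row_top r)) (col_top n r) (tcompl n (col_top n r))).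

Lemma appears_before_cat a b (s s' : seq nat) : a \in s -> b \notin s ->
  appears_before a b (s ++ s').
Proof.
move=> sa sb; rewrite /appears_before !index_cat sa (negPf sb).
by rewrite ltn_addr ?index_mem.
Qed.

(** Each step raises the sum of the entries by one, and this sum is at most n r. The strict bound on
    fuel plus sum thus excludes exhaustion before the top when r > 0; for r = 0 the empty tuple is
    already the top. *)
Lemma col_tower_sum f J : increasing_in n J -> size J = r ->
    (0 < r -> n * r < f + sumn J)%N ->
  pivots_ok n (col_tower_rec f n J) /\
  v (complement_entry (row_top r) J) = total_sum (col_tower_rec f n J) [::].
Proof.
have base : v (complement_entry (row_top r) (col_top n r)) = total_sum [::] [::].
  by rewrite /total_sum /signed_sum /= big_nat1 expr0 scale1r big_seq1 /= scale1r.
elim: f J => [|f IH] J hJ Jr fJ /=.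
  split=> //; rewrite -base; congr (v (complement_entry _ _)).
  case: (posnP r) => [r0|/fJ].
    by move: Jr; rewrite /col_top r0; apply: size0nil.
  by rewrite ltnNge add0n -Jr leq_sumn_increasing.
case: eqP => [->|/eqP nt]; first by rewrite Jr.
have [mn mJ m1J] := col_pivotP hJ nt; set m := col_pivot n J in mn mJ m1J *.
have nb : ~~ ((m \in J) && (m.+1 \in J)) by rewrite (negPf m1J) andbF.
have hJ1 := increasing_tact mn hJ nb.
have [sJ uJ J_n] := increasing_inP hJ.
have [|cs_ok IH1] := IH _ hJ1 (etrans (size_tact _ _) Jr).
  by rewrite sumn_tact // addnS => /fJ.
split; first by rewrite /= mn.
have [T [TD TZ Tv]] := col_stepH mn.
(* The operator is applied to the identity for [tact m J], which is one step closer to the top. *)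
rewrite -(total_sum_col mn cs_ok TD TZ Tv) -IH1 Tv; last first.
  apply: complement_entry_ok; rewrite ?increasing_iota //.
  by rewrite size_tact Jr size_iota.
have mJ1 : m \notin tact m J by rewrite mem_tact adj_low.
have m1J1 : m.+1 \in tact m J by rewrite mem_tact adj_high.
(* Below the step, m belongs to the complement and m+1 to the tuple; the complement is read first,
   so the operator yields one term. *)
have -> : in_phi m (complement_entry (row_top r) (tact m J)).
  have /andP[m0 /ltnW m_n] := mn.
  by apply: appears_before_cat; rewrite mem_tcompl ?mJ1 ?m1J1 ?andbF ?m0 ?m_n.
rewrite addr0; congr v; rewrite /complement_entry /col_act /=; congr Entry.
  by rewrite tact_tcompl ?tactK // (negPf mJ1) m1J1.
by rewrite tactK.
Qed.

(** The induction starts from the completed column tower. Each row step lowers the sum of the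
    entries by one; since entries are positive, sum zero means that the tuple is empty, which is
    then the top. *)
Lemma row_tower_sum f I J : increasing_in n I -> size I = r ->
    increasing_in n J -> size J = r -> (sumn I <= f)%N ->
  pivots_ok n (row_tower_rec f I) /\
  v (complement_entry I J) = total_sum (col_tower n J) (row_tower_rec f I).
Proof.
move=> + + hJ Jr; have [|cs_ok base] := col_tower_sum (f := n * size J) hJ Jr.
  rewrite -Jr; have [_ _] := increasing_inP hJ; case: (J) => //= j s J_n _.
  have /andP[j0 _] := J_n j (mem_head _ _).
  by rewrite -[X in (X < _)%N]addn0 ltn_add2l ltn_addr.
elim: f I => [|f IH] I hI Ir fI /=.
  split=> //; rewrite -base; congr (v (complement_entry _ _)).
  move: fI; rewrite -Ir; have [_ _] := increasing_inP hI; case: (I) => //= i s I_n.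
  by have /andP[i0 _] := I_n i (mem_head _ _); rewrite leqn0 addn_eq0; lia.
case: eqP => [->|/eqP nt]; first by rewrite Ir.
have [mn mI m1I] := row_pivotP hI nt; set m := row_pivot I in mn mI m1I *.
have nb : ~~ ((m \in I) && (m.+1 \in I)) by rewrite (negPf mI).
have hI1 := increasing_tact mn hI nb.
have [sI uI I_n] := increasing_inP hI.
have mI1 : m \in tact m I by rewrite mem_tact adj_low.
have m1I1 : m.+1 \notin tact m I by rewrite mem_tact adj_high.
have [|rs_ok IH1] := IH _ hI1 (etrans (size_tact _ _) Ir).
  move: fI; have := sumn_tact (etrans (tact_uniq m I) uI) mI1 m1I1.
  by rewrite tactK => ->.
split; first by rewrite /= mn.
have [T [TD TZ Tv]] := row_stepH mn.
rewrite -(total_sum_row mn cs_ok rs_ok TD TZ Tv) -IH1 Tv; last first.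
  by apply: complement_entry_ok => //; rewrite size_tact Jr Ir.
(* Here m+1 lies in the complement and m in the tuple, the order that psi singles out. *)
have -> : in_psi m (complement_entry (tact m I) J).
  have /andP[_ m_n] := mn.
  by apply: appears_before_cat; rewrite mem_tcompl ?mI1 ?m1I1 ?andbF ?m_n.
rewrite addr0; congr v; rewrite /complement_entry /row_act /=; congr Entry.
  by rewrite tact_tcompl ?tactK // (negPf m1I1) mI1.
by rewrite tactK.
Qed.

End Sums.

Theorem minor_complement_expansion (R : comNzRingType) (t tV : R) (n r : nat)
    (I J : seq nat) :
    t * tV = 1 -> increasing_in n I -> increasing_in n J ->
    size I = r -> size J = r ->
  entry_val t tV n (complement_entry n I J) =
  total_sum (entry_val t tV n) n r (tV - t) (col_tower n J) (row_tower n I).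
Proof.
move=> t_inv hI hJ Ir Jr.
have rn : (r <= n)%N by rewrite -Jr; apply: increasing_size.
set v := entry_val t tV n.
have hcol m : (0 < m < n)%N -> exists T : qmat t tV n -> qmat t tV n,
    [/\ forall u w, T (u + w) = T u + T w, forall c u, T (c *: u) = c *: T u &
      forall c, entry_ok n c -> T (v c) = v (col_act m c) +
        (if in_phi m c then 0 else (- (tV - t)) *: v c)].
  by case/andP=> m0 mn; rewrite opprB; apply: col_step.
have hrow m : (0 < m < n)%N -> exists T : qmat t tV n -> qmat t tV n,
    [/\ forall u w, T (u + w) = T u + T w, forall c u, T (c *: u) = c *: T u &
      forall c, entry_ok n c -> T (v c) = v (row_act m c) +
        (if in_psi m c then 0 else (tV - t) *: v c)].
  by case/andP=> m0 mn; apply: row_step.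
have hbase : v (complement_entry n (row_top r) (col_top n r)) =
  v (Entry 1 (row_top r) (tcompl n (row_top r)) (col_top n r) (tcompl n (col_top n r))).
  have irow : increasing_in n (row_top r) by apply: increasing_iota.
  have icol : increasing_in n (col_top n r) by apply: increasing_iota; lia.
  (* At the top the tuples are rows 1..r and columns n-r+1..n, so every generator of their minor has
     a smaller row and a larger column than every generator of the complementary minor. *)
  apply: esym; apply: commute_minor.
  - by rewrite !size_iota.
  - by rewrite !size_tcompl // !size_iota.
  - exact: iota_uniq.
  - by apply: filter_uniq; apply: iota_uniq.
  - by move=> i l; rewrite mem_tcompl !mem_iota; lia.
  - by move=> i l; rewrite mem_tcompl !mem_iota; lia.
have vs e c : v (set_sign e c) = v c.
  by rewrite /v /entry_val; exact: erefl.
have [_ main] := @row_tower_sum R (qmat t tV n) v n r (tV - t) rn vs hcol hrow hbase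
  (n * size I) I J hI Ir hJ Jr (leq_sumn_increasing hI).
exact: main.
Qed.

Theorem mainTheorem4 (k : fieldType) (n r : nat) (I J : r.-tuple nat)
    (hI : increasing_in n I) (hJ : increasing_in n J) :
  let M := size (col_tower n J) in
  let N := size (row_tower n I) in
  qminor k n (tcompl n I) (tcompl n J) * qminor k n I J =
  \sum_(0 <= i < (M + N).+1)
    (qinv k - q k) ^+ i *:
      \sum_(c <- Clist n I J i)
        (esign c)%:~R *:
          (qminor k n (eZ c) (eW c) * qminor k n (eZ' c) (eW' c)).
Proof.
move=> M N.
have e := minor_complement_expansion (q_qinv k) hI hJ (size_tuple I) (size_tuple J).
apply: (etrans e).
by rewrite /total_sum /signed_sum /M /N /Clist (size_tuple J); exact: erefl.
Qed.
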